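(* Let $u_0\in C^{k,\theta}(\mathbb R)$, $k\in\mathbb Z$, $k\ge0$, $\theta\in[0,1]$, let $\Omega\subseteq\mathbb R$ be an open set, and let $u\in C([-T,T]:C^{k,\theta}(\mathbb R))$ be the corresponding local solution of $$\partial_t u+(1-\partial_x^2)^{-1}(\partial_x u+u\,\partial_x u)=0,\qquad u(x,0)=u_0(x),\quad x\in\mathbb R.$$ (a) If $u_0\in C^{j,\eta}(\Omega)$ with $j\in\{k,k+1\}$, $\eta\in[0,1]$ and $j+\eta\le k+1+\theta$, then $u|_\Omega\in C^\infty([-T,T]:C^{j,\eta}(\Omega))$. (b) If $u_0\notin C^{j,\eta}(\Omega)$ with $j\in\{k,k+1\}$, $\eta\in[0,1]$ and $j+\eta\le k+1+\theta$, then $u(\cdot,t)|_\Omega\notin C^{j,\eta}(\Omega)$ for all $t\in[-T,T]$.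
   Context: $C^{k,\theta}(\mathbb R)$ ($k\ge0$ integer, $\theta\in[0,1]$) is the space of $f:\mathbb R\to\mathbb R$ of class $C^k$ with bounded derivatives up to order $k$ and finite norm $\|f\|_{C^{k,\theta}}=\sum_{i=0}^k\|f^{(i)}\|_\infty+\sup_{h\ne0}\||h|^{-\theta}(f^{(k)}(\cdot+h)-f^{(k)}(\cdot))\|_\infty$. For $\Omega\subset\mathbb R$ open, $f:\Omega\to\mathbb R$ belongs to $C^{k,\theta}(\Omega)$ if there is $F\in C^{k,\theta}(\mathbb R)$ with $F|_\Omega=f$; its norm is the infimum of $\|F\|_{C^{k,\theta}}$ over all such extensions. For $u_0$ defined on $\mathbb R$, ''$u_0\in C^{j,\eta}(\Omega)$'' means $u_0|_\Omega\in C^{j,\eta}(\Omega)$. The equation is understood in the integral form $u(t)=u_0-\int_0^t\partial_x(1-\partial_x^2)^{-1}\big(u+\tfrac{u^2}{2}\big)(t')\,dt'$, where $\partial_x(1-\partial_x^2)^{-1}g=K*g$ with $K(x)=-\tfrac12\,\mathrm{sgn}(x)e^{-|x|}$. For every $u_0\in C^{k,\theta}(\mathbb R)$ there exist $T=T(\|u_0\|_{C^{k,\theta}})>0$ and a unique solution $u\in C([-T,T]:C^{k,\theta}(\mathbb R))$. *)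

(* Defs.v *)
From Stdlib Require Export Reals.
From Coquelicot Require Export Coquelicot.

Open Scope R_scope.

(** A class of real functions on [D] with a norm.  The norm is [Rbar]-valued
    and meaningful only on [mem]. *)
Record fspace (D : Type) := FSpace {
  mem : (D -> R) -> Prop;
  norm_of : (D -> R) -> Rbar
}.
Arguments FSpace {D} _ _.
Arguments mem {D} _ _.
Arguments norm_of {D} _ _.

(** * Hölder spaces *)

Definition sup_norm (f : R -> R) : Rbar :=
  Lub_Rbar (fun y => exists x, y = Rabs (f x)).

Definition holder_seminorm (theta : R) (f : R -> R) : Rbar :=
  Rbar_lub (fun y => exists h, h <> 0 /\
    y = sup_norm (fun x => Rpower (Rabs h) (- theta) * (f (x + h) - f x))).

(** [Rbar_sum a k = a 0 + ... + a k], with [k + 1] terms, as for [sum_f_R0].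
    All uses have nonnegative terms, so [Rbar_plus] never meets
    [p_infty + m_infty]. *)
Fixpoint Rbar_sum (a : nat -> Rbar) (k : nat) : Rbar :=
  match k with
  | O => a O
  | S i => Rbar_plus (Rbar_sum a i) (a (S i))
  end.

Definition holder_norm (k : nat) (theta : R) (f : R -> R) : Rbar :=
  Rbar_plus (Rbar_sum (fun i => sup_norm (Derive_n f i)) k)
            (holder_seminorm theta (Derive_n f k)).

(** [Derive_n] is total, so existence of the derivatives is a separate
    requirement; continuity of those of order [< k] is automatic. *)
Definition class_C (k : nat) (f : R -> R) : Prop :=
  (forall i x, (i <= k)%nat -> ex_derive_n f i x) /\
  (forall x, continuous (Derive_n f k) x).

(** Finiteness of the norm includes boundedness of the derivatives. *)
Definition Holder (k : nat) (theta : R) : fspace R :=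
  FSpace (fun f => class_C k f /\ is_finite (holder_norm k theta f))
         (holder_norm k theta).

Definition restr (Omega : R -> Prop) (f : R -> R) : {x : R | Omega x} -> R :=
  fun x => f (proj1_sig x).

Definition extends (Omega : R -> Prop) (F : R -> R)
    (f : {x : R | Omega x} -> R) : Prop :=
  forall x, restr Omega F x = f x.

Definition HolderOn (k : nat) (theta : R) (Omega : R -> Prop) :
    fspace {x : R | Omega x} :=
  FSpace
    (fun f => exists F, mem (Holder k theta) F /\ extends Omega F f)
    (fun f => Rbar_glb (fun y => exists F,
       mem (Holder k theta) F /\ extends Omega F f /\
       y = norm_of (Holder k theta) F)).

(** * Curves in a function space over [[-T, T]]

    A curve is a map [v : R -> D -> R], time first; its values at times
    outside [[-T, T]] are irrelevant. *)
Section Curves.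

Context {D : Type} (X : fspace D) (T : R).

Definition time (t : R) : Prop := - T <= t <= T.

Definition curve_continuous (v : R -> D -> R) : Prop :=
  (forall t, time t -> mem X (v t)) /\
  forall t, time t -> forall eps : posreal,
    within time (locally t)
      (fun s => Rbar_lt (norm_of X (fun x => v s x - v t x)) eps).

(** Convergence of the difference quotients in the norm of [X], one-sided at
    the endpoints of the interval. *)
Definition curve_derivative (v w : R -> D -> R) : Prop :=
  forall t, time t -> forall eps : posreal,
    within time (locally' t)
      (fun s => Rbar_lt
         (norm_of X (fun x => (v s x - v t x) / (s - t) - w t x)) eps).

Fixpoint curve_C (n : nat) (v : R -> D -> R) : Prop :=
  match n with
  | O => curve_continuous v
  | S m => (forall t, time t -> mem X (v t)) /\
           exists w, curve_derivative v w /\ curve_C m w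
  end.

Definition curve_smooth (v : R -> D -> R) : Prop := forall n, curve_C n v.

End Curves.

(** * The equation *)

Definition kernel (x : R) : R := - (1 / 2) * sign x * exp (- Rabs x).

Definition conv (K g : R -> R) (x : R) : R :=
  RInt_gen (fun y => K (x - y) * g y)
    (Rbar_locally m_infty) (Rbar_locally p_infty).

(** [RInt _ 0 t] is the oriented integral, so [t < 0] is covered.  For a
    continuous curve in [Holder k theta] both integrals exist. *)
Definition is_solution (k : nat) (theta : R) (T : R) (u0 : R -> R)
    (u : R -> R -> R) : Prop :=
  curve_continuous (Holder k theta) T u /\
  forall t x, time T t ->
    u t x = u0 x -
      RInt (fun s => conv kernel (fun y => u s y + (u s y) ^ 2 / 2) x) 0 t.

(* Main.v *)
Require Import Defs.
From Stdlib Require Import Lra Lia FunctionalExtensionality Classical IndefiniteDescription.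

(** The convolution with [kernel] gains one derivative: it is [-(p + q)/2],
    where [p] and [q] are the bounded solutions of [p' = g - p] and
    [q' = g + q]. It is therefore bounded and linear from [C^{k,theta}] to
    [C^{k+1,theta}], which embeds in [C^{j,eta}]. Hence [u = u0 - Phi] with
    [Phi' = K * (u + u^2/2)]; as [C^{k,theta}] is an algebra, if [u] is [C^n]
    in time with values in [C^{k,theta}] then so is [Phi'], and [u] is
    [C^{n+1}]. Thus [Phi] is smooth in time with values in [C^{k+1,theta}], and
    both [u0] and [u(t)], at every time, have the same [C^{j,eta}] regularity
    on [Omega]. *)

(** * Hölder bounds *)

(** The estimates avoid suprema and infima in [Rbar]: a norm is replaced by the relation that [M]
    bounds it, which agrees with the norm up to a factor depending only on the order. Only
    finiteness and convergence to zero are at stake, so such factors are harmless. The relation also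
    carries differentiability, which a norm built on the total [Derive_n] cannot see. The derivative
    gained in space has to be thrown away during the bootstrap in time, because [u] contains [u0]
    and stays at order [k]; it is kept only in one last pass, once [u] is known to be smooth in
    time. The delicate point of each pass is that an integral taken pointwise in [x] must be
    differentiable in time for the Hölder norm, so spatial derivatives have to be moved under the
    time integral. All of this takes place on the whole line. The set [Omega] enters only when an
    extension of [u0] or of [u t] is combined with [Phi] and restricted. *)

(* [holder_le k theta f M]: every term of the norm of [f] in [C^{k,theta}] is
   at most [M]. The recursion is on the derivative, so that estimates go by
   induction on [k]. *)
Fixpoint holder_le (k : nat) (theta : R) (f : R -> R) (M : R) : Prop :=
  match k with
  | O => (forall x, continuous f x) /\ (forall x, Rabs (f x) <= M) /\
         forall x y, x <> y -> Rabs (f x - f y) <= M * Rpower (Rabs (x - y)) theta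
  | S i => (forall x, Rabs (f x) <= M) /\ (forall x, ex_derive f x) /\
           holder_le i theta (Derive f) M
  end.

Lemma Rpower_pos (x y : R) : 0 < Rpower x y.
Proof. apply exp_pos. Qed.

Lemma Rabs_minus_pos (x y : R) : x <> y -> 0 < Rabs (x - y).
Proof. intros H; apply Rabs_pos_lt; lra. Qed.

(** Among exponents in [[0,1]] the power is smallest at 0 when [1 <= h] and at 1 when [h < 1]. This
    turns a sup bound and a Lipschitz bound, taken together, into a Hölder bound. *)
Lemma Rpower_ge_min (h theta : R) :
  0 < h -> 0 <= theta <= 1 -> Rmin 1 h <= Rpower h theta.
Proof.
  intros Hh Ht; destruct (Rle_lt_dec 1 h) as [H|H].
  - rewrite Rmin_left by lra; rewrite <- (Rpower_O h) by lra.
    now apply Rle_Rpower.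
  - rewrite Rmin_right by lra.
    rewrite <- (Rpower_1 h) at 1 by lra.
    unfold Rpower; destruct (Req_dec theta 1) as [->|Hn]; [lra|].
    left; apply exp_increasing.
    assert (ln h < 0) by (rewrite <- ln_1; apply ln_increasing; lra); nra.
Qed.

Lemma Rpower_min_mono (h theta eta : R) :
  0 < h -> 0 <= eta <= theta -> Rmin 1 (Rpower h theta) <= Rpower h eta.
Proof.
  intros Hh He; destruct (Rle_lt_dec 1 h) as [H|H].
  - apply Rle_trans with 1; [apply Rmin_l|].
    rewrite <- (Rpower_O h) by lra; now apply Rle_Rpower.
  - apply Rle_trans with (Rpower h theta); [apply Rmin_r|].
    unfold Rpower; destruct (Req_dec theta eta) as [->|Hn]; [lra|].
    left; apply exp_increasing.
    assert (ln h < 0) by (rewrite <- ln_1; apply ln_increasing; lra); nra.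
Qed.

Lemma holder_le_bound k theta f M :
  holder_le k theta f M -> forall x, Rabs (f x) <= M.
Proof. destruct k; intros H; apply H. Qed.

Lemma holder_le_nonneg k theta f M : holder_le k theta f M -> 0 <= M.
Proof.
  intros H; apply Rle_trans with (Rabs (f 0)); [apply Rabs_pos|].
  exact (holder_le_bound _ _ _ _ H 0).
Qed.

Lemma holder_le_continuous k theta f M :
  holder_le k theta f M -> forall x, continuous f x.
Proof.
  destruct k; intros H x; [apply H|]; apply (ex_derive_continuous f), H.
Qed.

Lemma holder_le_S k theta f f' M :
  (forall x, Rabs (f x) <= M) -> (forall x, is_derive f x (f' x)) ->
  holder_le k theta f' M -> holder_le (S k) theta f M.
Proof.
  intros Hb Hd H; repeat split; [exact Hb|intros x; exists (f' x); apply Hd|].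
  replace (Derive f) with f'; [exact H|].
  apply functional_extensionality; intros x; symmetry; apply is_derive_unique, Hd.
Qed.

Lemma holder_le_weaken k theta f A B :
  holder_le k theta f A -> A <= B -> holder_le k theta f B.
Proof.
  revert f; induction k as [|k IH]; intros f H HAB.
  - destruct H as (Hc & Hb & Hh); repeat split; [exact Hc|intros x; specialize (Hb x); lra|].
    intros x y Hxy; apply Rle_trans with (1 := Hh x y Hxy).
    apply Rmult_le_compat_r; [left; apply Rpower_pos|exact HAB].
  - destruct H as (Hb & Hd & Hh); repeat split;
      [intros x; specialize (Hb x); lra|exact Hd|now apply IH].
Qed.

Lemma holder_le_lincomb k theta a b f g A B :
  holder_le k theta f A -> holder_le k theta g B ->
  holder_le k theta (fun x => a * f x + b * g x) (Rabs a * A + Rabs b * B).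
Proof.
  assert (Habs : forall u v A B, Rabs u <= A -> Rabs v <= B ->
            Rabs (a * u + b * v) <= Rabs a * A + Rabs b * B).
  { intros u v A' B' Hu Hv; eapply Rle_trans; [apply Rabs_triang|].
    rewrite !Rabs_mult; apply Rplus_le_compat;
      apply Rmult_le_compat_l; auto using Rabs_pos. }
  revert f g; induction k as [|k IH]; intros f g Hf Hg.
  - destruct Hf as (Hc & Hb & Hh), Hg as (Hc' & Hb' & Hh'); repeat split.
    + intros x; apply (continuous_plus (fun x => a * f x) (fun x => b * g x));
        now apply (continuous_scal_r _ (_ : R -> R_NormedModule)).
    + intros x; auto.
    + intros x y Hxy.
      replace (_ - _) with (a * (f x - f y) + b * (g x - g y)) by ring.
      rewrite Rmult_plus_distr_r, !Rmult_assoc; auto.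
  - destruct Hf as (Hb & Hd & Hh), Hg as (Hb' & Hd' & Hh').
    apply holder_le_S with (fun x => a * Derive f x + b * Derive g x); auto.
    intros x; apply (is_derive_plus (fun x => a * f x) (fun x => b * g x));
      apply is_derive_scal, Derive_correct; auto.
Qed.

(** Far points are compared by the sup bound, near points by the mean value theorem. The factor 2
    comes from the far points, where an increment may reach [2 * M]. *)
Lemma holder_le_lipschitz eta f f' M :
  0 <= eta <= 1 -> (forall x, Rabs (f x) <= M) ->
  (forall x, is_derive f x (f' x)) -> (forall x, Rabs (f' x) <= M) ->
  holder_le 0 eta f (2 * M).
Proof.
  intros He Hb Hd Hb'.
  assert (HM : 0 <= M) by (apply Rle_trans with (2 := Hb 0), Rabs_pos).
  repeat split.
  - intros x; apply (ex_derive_continuous f); exists (f' x); apply Hd.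
  - intros x; specialize (Hb x); lra.
  - intros x y Hxy.
    assert (Hp := Rabs_minus_pos x y Hxy).
    apply Rle_trans with (2 * M * Rmin 1 (Rabs (x - y)));
      [|apply Rmult_le_compat_l; [lra|now apply Rpower_ge_min]].
    apply Rmin_case.
    + eapply Rle_trans; [apply Rabs_triang|]; rewrite Rabs_Ropp.
      generalize (Hb x) (Hb y); lra.
    + destruct (MVT_gen f y x f') as (c & _ & ->).
      * intros z _; apply Hd.
      * intros z _; apply continuity_pt_filterlim, (ex_derive_continuous f).
        exists (f' z); apply Hd.
      * rewrite Rabs_mult; apply Rmult_le_compat_r; [lra|].
        specialize (Hb' c); lra.
Qed.

Lemma holder_le_exponent k theta eta f M :
  0 <= eta <= theta -> holder_le k theta f M -> holder_le k eta f (2 * M).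
Proof.
  intros He; revert f; induction k as [|k IH]; intros f H;
    assert (HM := holder_le_nonneg _ _ _ _ H).
  - destruct H as (Hc & Hb & Hh); repeat split;
      [exact Hc|intros x; specialize (Hb x); lra|].
    intros x y Hxy; assert (Hp := Rabs_minus_pos x y Hxy).
    apply Rle_trans with (2 * M * Rmin 1 (Rpower (Rabs (x - y)) theta));
      [|apply Rmult_le_compat_l; [lra|now apply Rpower_min_mono]].
    apply Rmin_case.
    + eapply Rle_trans; [apply Rabs_triang|]; rewrite Rabs_Ropp.
      generalize (Hb x) (Hb y); lra.
    + apply Rle_trans with (1 := Hh x y Hxy).
      apply Rmult_le_compat_r; [left; apply Rpower_pos|lra].
  - destruct H as (Hb & Hd & Hh); repeat split; [|exact Hd|now apply IH].
    intros x; specialize (Hb x); lra.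
Qed.

(** One spare derivative buys every exponent in [[0,1]], even [eta > theta]: the function of order
    [k] is then bounded and Lipschitz. *)
Lemma holder_le_lower k theta eta f M :
  0 <= eta <= 1 -> holder_le (S k) theta f M -> holder_le k eta f (2 * M).
Proof.
  intros He; revert f; induction k as [|k IH]; intros f (Hb & Hd & H).
  - apply holder_le_lipschitz with (Derive f); auto.
    + intros x; now apply Derive_correct.
    + apply H.
  - assert (HM := holder_le_nonneg _ _ _ _ H).
    repeat split; [|exact Hd|now apply IH].
    intros x; specialize (Hb x); lra.
Qed.

(** The product rule pairs a derivative of order [k] with a factor of order [k + 1], and
    [holder_le_lower] brings the latter down at the price of a factor 2. The two terms give [4 * C];
    the added 1 covers the sup norm of the product itself. *)
Lemma holder_le_mult k theta :
  0 <= theta <= 1 -> exists C, 0 < C /\ forall f g A B,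
    holder_le k theta f A -> holder_le k theta g B ->
    holder_le k theta (fun x => f x * g x) (C * (A * B)).
Proof.
  intros Ht; induction k as [|k (C & HC & IH)].
  - exists 2; split; [lra|]; intros f g A B Hf Hg.
    assert (HA := holder_le_nonneg _ _ _ _ Hf).
    assert (HB := holder_le_nonneg _ _ _ _ Hg).
    assert (0 <= A * B) by now apply Rmult_le_pos.
    destruct Hf as (Hc & Hb & Hh), Hg as (Hc' & Hb' & Hh'); repeat split.
    + intros x; now apply (continuous_mult (K := R_AbsRing) f g).
    + intros x; rewrite Rabs_mult.
      apply Rle_trans with (A * B); [|lra].
      apply Rmult_le_compat; auto using Rabs_pos.
    + intros x y Hxy.
      replace (_ - _) with (f x * (g x - g y) + (f x - f y) * g y) by ring.
      eapply Rle_trans; [apply Rabs_triang|]; rewrite !Rabs_mult.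
      set (p := Rpower _ _) in *.
      apply Rle_trans with (A * (B * p) + A * p * B); [|right; ring].
      apply Rplus_le_compat; apply Rmult_le_compat; auto using Rabs_pos.
  - exists (4 * C + 1); split; [lra|]; intros f g A B Hf Hg.
    assert (HA := holder_le_nonneg _ _ _ _ Hf).
    assert (HB := holder_le_nonneg _ _ _ _ Hg).
    assert (0 <= A * B) by now apply Rmult_le_pos.
    assert (0 <= C * (A * B)) by (apply Rmult_le_pos; lra).
    assert (Hf0 := holder_le_lower _ _ theta _ _ Ht Hf).
    assert (Hg0 := holder_le_lower _ _ theta _ _ Ht Hg).
    destruct Hf as (Hb & Hd & Hh), Hg as (Hb' & Hd' & Hh').
    apply holder_le_S with (fun x => Derive f x * g x + f x * Derive g x).
    + intros x; rewrite Rabs_mult.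
      apply Rle_trans with (A * B); [|lra].
      apply Rmult_le_compat; auto using Rabs_pos.
    + intros x; apply (is_derive_mult f g); auto using Derive_correct.
      intros; apply Rmult_comm.
    + generalize (holder_le_lincomb _ _ 1 1 _ _ _ _
        (IH _ _ _ _ Hh Hg0) (IH _ _ _ _ Hf0 Hh')).
      rewrite Rabs_R1; intros H1.
      replace (fun x => Derive f x * g x + f x * Derive g x)
        with (fun x => 1 * (Derive f x * g x) + 1 * (f x * Derive g x))
        by (apply functional_extensionality; intros; ring).
      apply holder_le_weaken with (1 := H1); nra.
Qed.

(** The equation trades each derivative of [f] for [g] and [f] at one order less. A sup bound on [f]
    has to be assumed, since the homogeneous solutions [exp (c * x)] are unbounded. *)
Lemma holder_le_ode k theta c :
  0 <= theta <= 1 -> Rabs c = 1 -> exists C, 0 < C /\ forall f g M,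
    (forall x, is_derive f x (g x + c * f x)) -> (forall x, Rabs (f x) <= M) ->
    holder_le k theta g M -> holder_le k theta f (C * M).
Proof.
  intros Ht Hc; induction k as [|k (C & HC & IH)].
  - exists 4; split; [lra|]; intros f g M Hd Hb Hg.
    assert (HM := holder_le_nonneg _ _ _ _ Hg).
    replace (4 * M) with (2 * (2 * M)) by ring.
    apply holder_le_lipschitz with (fun x => g x + c * f x); auto.
    + intros x; specialize (Hb x); lra.
    + intros x; eapply Rle_trans; [apply Rabs_triang|].
      rewrite Rabs_mult, Hc; assert (Hgx := holder_le_bound _ _ _ _ Hg x).
      specialize (Hb x); lra.
  - exists (2 + 2 * C); split; [lra|]; intros f g M Hd Hb Hg.
    assert (HM := holder_le_nonneg _ _ _ _ Hg).
    assert (0 <= C * M) by (apply Rmult_le_pos; lra).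
    assert (Hg0 := holder_le_lower _ _ theta _ _ Ht Hg).
    apply holder_le_S with (2 := Hd); [intros x; specialize (Hb x); lra|].
    assert (Hf0 : holder_le k theta f (C * (2 * M))).
    { apply IH with (1 := Hd); [intros x; specialize (Hb x); lra|exact Hg0]. }
    generalize (holder_le_lincomb _ _ 1 c _ _ _ _ Hg0 Hf0).
    rewrite Rabs_R1, Hc; intros H1.
    replace (fun x => g x + c * f x) with (fun x => 1 * g x + c * f x)
      by (apply functional_extensionality; intros; ring).
    apply holder_le_weaken with (1 := H1); lra.
Qed.

(** * Convolution with the kernel *)

(** The integrand is dominated by [M * exp (c * y)], with primitive [c * M * exp (c * y)] because
    [1 / c = c]. The absolute value on the right covers both signs of [c] and both orientations. *)
Lemma abs_RInt_exp_le (c : R) (g : R -> R) (M a b : R) :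
  Rabs c = 1 -> (forall x, continuous g x) -> (forall x, Rabs (g x) <= M) ->
  Rabs (RInt (fun y => exp (c * y) * g y) a b) <= M * Rabs (exp (c * b) - exp (c * a)).
Proof.
  intros Hc Hg Hb.
  assert (Hcc : c * c = 1) by (unfold Rabs in Hc; destruct Rcase_abs in Hc; nra).
  assert (HM : 0 <= M) by (apply Rle_trans with (2 := Hb 0), Rabs_pos).
  assert (Hex : forall a b, ex_RInt (fun y => exp (c * y) * g y) a b).
  { intros a' b'; apply (ex_RInt_continuous (V := R_CompleteNormedModule)); intros z _.
    apply (continuous_mult (K := R_AbsRing) (fun y => exp (c * y)) g); [|apply Hg].
    apply (ex_derive_continuous (fun y => exp (c * y))); auto_derive; auto. }
  assert (Hle : forall a b, a <= b ->
    Rabs (RInt (fun y => exp (c * y) * g y) a b) <= M * Rabs (exp (c * b) - exp (c * a))).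
  { clear a b; intros a b Hab.
    apply Rle_trans with (c * M * exp (c * b) - c * M * exp (c * a)).
    - apply (norm_RInt_le (V := R_NormedModule) (fun y => exp (c * y) * g y)
        (fun y => M * exp (c * y)) a b);
        [exact Hab| |apply (RInt_correct (V := R_CompleteNormedModule)); auto|].
      + intros x _; change (Rabs (exp (c * x) * g x) <= M * exp (c * x)).
        rewrite Rabs_mult, (Rabs_right (exp _)) by (left; apply exp_pos).
        rewrite Rmult_comm; apply Rmult_le_compat_r; [left; apply exp_pos|apply Hb].
      + apply (is_RInt_derive (fun y => c * M * exp (c * y))).
        * intros x _; auto_derive; [trivial|].
          transitivity ((c * c) * (M * exp (c * x))); [ring|]; rewrite Hcc; ring.
        * intros x _; apply (ex_derive_continuous (fun y => M * exp (c * y))); auto_derive; auto.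
    - replace (c * M * exp (c * b) - c * M * exp (c * a))
        with (M * (c * (exp (c * b) - exp (c * a)))) by ring.
      apply Rmult_le_compat_l; [exact HM|].
      apply Rle_trans with (1 := Rle_abs _); rewrite Rabs_mult, Hc; lra. }
  destruct (Rle_dec a b) as [H|H]; [auto|].
  rewrite <- (opp_RInt_swap (V := R_CompleteNormedModule)) by auto.
  change (Rabs (- RInt (fun y => exp (c * y) * g y) b a) <= M * Rabs (exp (c * b) - exp (c * a))).
  rewrite Rabs_Ropp, Rabs_minus_sym; apply Hle; lra.
Qed.

(* [c = 1], [F = -oo] gives the left half of the convolution with
   [exp (- |x|)], and [c = -1], [F = +oo] gives minus its right half. *)
Lemma exp_average (c : R) (F : (R -> Prop) -> Prop) {FF : ProperFilter F}
    (g : R -> R) (M : R) :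
  Rabs c = 1 -> filterlim (fun a => exp (c * a)) F (locally 0) ->
  (forall x, continuous g x) -> (forall x, Rabs (g x) <= M) ->
  exists f : R -> R, (forall x, is_derive f x (g x + - c * f x)) /\
    (forall x, Rabs (f x) <= M) /\
    forall x, is_RInt_gen (fun y => exp (c * (y - x)) * g y) F (at_point x) (f x).
Proof.
  intros Hc HF Hg Hb.
  assert (HM : 0 <= M) by (apply Rle_trans with (2 := Hb 0), Rabs_pos).
  set (k := fun y => exp (c * y) * g y).
  assert (Hk : forall y, continuous k y).
  { intros y.
    apply (continuous_mult (K := R_AbsRing) (fun y => exp (c * y)) g); [|apply Hg].
    apply (ex_derive_continuous (fun y => exp (c * y))); auto_derive; auto. }
  assert (Hex : forall a b, ex_RInt k a b)
    by (intros; apply (ex_RInt_continuous (V := R_CompleteNormedModule)); auto).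
  set (G := RInt k 0 : R -> R).
  assert (HG : forall a b, RInt k a b = G b - G a).
  { intros a b; apply (Rplus_eq_reg_l (G a)); transitivity (G b); [|ring].
    now apply (RInt_Chasles (V := R_CompleteNormedModule)). }
  assert (HGb : forall a b, Rabs (G b - G a) <= M * Rabs (exp (c * b) - exp (c * a)))
    by (intros a b; rewrite <- HG; now apply abs_RInt_exp_le).
  assert (Hlim : forall eps : posreal, F (fun a => exp (c * a) < eps)).
  { intros eps; generalize (proj1 (filterlim_locally _ _) HF eps); apply filter_imp.
    intros a Ha; change (Rabs (exp (c * a) - 0) < eps) in Ha.
    rewrite Rminus_0_r in Ha; apply Rle_lt_trans with (2 := Ha), Rle_abs. }
  (* Increments of [G] are controlled by those of [exp (c * a)], which tends to 0 along [F].
     Dividing by [M + 1] allows [M = 0]. *)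
  assert (Hcauchy : exists l : R, filterlim G F (locally l)).
  { apply (filterlim_locally_cauchy (U := R_CompleteSpace) G); intros eps.
    assert (He : 0 < eps / (M + 1)) by (apply Rdiv_lt_0_compat; [apply eps|lra]).
    exists (fun a => exp (c * a) < eps / (M + 1)); split; [apply (Hlim (mkposreal _ He))|].
    intros a b Ha Hb'; change (Rabs (G b - G a) < eps).
    apply Rle_lt_trans with (1 := HGb a b).
    generalize (exp_pos (c * a)) (exp_pos (c * b)); intros.
    apply Rle_lt_trans with (M * (eps / (M + 1))).
    - apply Rmult_le_compat_l; [lra|]; apply Rabs_le; lra.
    - apply Rlt_le_trans with ((M + 1) * (eps / (M + 1))); [nra|].
      right; field; lra. }
  destruct Hcauchy as [l Hl].
  assert (Hl' := proj1 (filterlim_locally _ _) Hl).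
  (* Variation of constants: [G x - l] is the integral of [k] from the end of the line described by
     [F] up to [x]. *)
  exists (fun x => exp (- (c * x)) * (G x - l)); split; [|split].
  - intros x.
    assert (HdG : is_derive G x (k x)).
    { apply (is_derive_RInt (V := R_NormedModule) k G 0); [|apply Hk].
      apply filter_forall; intros y; apply (RInt_correct (V := R_CompleteNormedModule)); auto. }
    auto_derive; [eexists; exact HdG|].
    replace (Derive (fun x0 => G x0) x) with (k x) by (symmetry; now apply is_derive_unique).
    unfold k; replace (1 * (exp (c * x) * g x)) with (g x * exp (c * x)) by ring.
    rewrite exp_Ropp; field; apply Rgt_not_eq, exp_pos.
  - intros x; rewrite Rabs_mult, (Rabs_right (exp _)) by (left; apply exp_pos).
    assert (H : Rabs (G x - l) <= M * exp (c * x)).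
    (* If the bound failed by [d > 0], a point [a] far along [F] would make both [exp (c * a)] and
       the distance from [G a] to [l] less than [d / (M + 1)]; the total error would then stay below
       [d]. *)
    { apply Rnot_lt_le; intros Hlt.
      set (d := Rabs (G x - l) - M * exp (c * x)).
      assert (Hd : 0 < d / (M + 1)) by (apply Rdiv_lt_0_compat; unfold d; lra).
      destruct (filter_ex _ (filter_and _ _ (Hl' (mkposreal _ Hd)) (Hlim (mkposreal _ Hd))))
        as (a & H1 & H2).
      change (Rabs (G a - l) < d / (M + 1)) in H1; simpl in H2.
      assert (H3 : Rabs (G x - l) <= Rabs (G x - G a) + Rabs (G a - l)).
      { replace (G x - l) with ((G x - G a) + (G a - l)) by ring; apply Rabs_triang. }
      assert (H4 : Rabs (exp (c * x) - exp (c * a)) <= exp (c * x) + exp (c * a)).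
      { generalize (exp_pos (c * a)) (exp_pos (c * x)); intros; apply Rabs_le; lra. }
      assert (H5 : M * Rabs (exp (c * x) - exp (c * a)) <= M * (exp (c * x) + exp (c * a)))
        by now apply Rmult_le_compat_l.
      assert (H6 : (M + 1) * (d / (M + 1)) = d) by (field; lra).
      assert (H7 : M * exp (c * a) <= M * (d / (M + 1)))
        by (apply Rmult_le_compat_l; lra).
      specialize (HGb a x); unfold d in *; lra. }
    apply Rmult_le_compat_l with (r := exp (- (c * x))) in H; [|left; apply exp_pos].
    apply Rle_trans with (1 := H); right.
    rewrite exp_Ropp; field; apply Rgt_not_eq, exp_pos.
  - intros x; apply filterlimi_locally; intros eps.
    assert (He : 0 < eps * exp (c * x)) by (apply Rmult_lt_0_compat; [apply eps|apply exp_pos]).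
    apply Filter_prod with (1 := Hl' (mkposreal _ He)) (R := fun b => b = x); [reflexivity|].
    intros a b Ha ->; change (Rabs (G a - l) < eps * exp (c * x)) in Ha; simpl.
    exists (exp (- (c * x)) * (G x - G a)); split.
    + rewrite <- HG.
      apply is_RInt_ext with (fun y => scal (exp (- (c * x))) (k y)).
      * intros y _; unfold scal, k; simpl; unfold mult; simpl.
        rewrite <- Rmult_assoc, <- exp_plus; f_equal; f_equal; ring.
      * apply (is_RInt_scal (V := R_NormedModule)),
          (RInt_correct (V := R_CompleteNormedModule)), Hex.
    + change (Rabs (exp (- (c * x)) * (G x - G a) - exp (- (c * x)) * (G x - l)) < eps).
      replace (_ - _) with (- (exp (- (c * x)) * (G a - l))) by ring.
      rewrite Rabs_Ropp, Rabs_mult, (Rabs_right (exp _)) by (left; apply exp_pos).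
      apply Rmult_lt_compat_l with (r := exp (- (c * x))) in Ha; [|apply exp_pos].
      apply Rlt_le_trans with (1 := Ha); right.
      rewrite exp_Ropp; field; apply Rgt_not_eq, exp_pos.
Qed.

(** The kernel jumps at [y = x], so the integral is cut there into two exponential averages.
    Convergence is recorded in the last conjunct because [RInt_gen] is total and its value alone
    does not provide it. *)
Lemma conv_kernel_spec (g : R -> R) (M : R) :
  (forall x, continuous g x) -> (forall x, Rabs (g x) <= M) ->
  exists p q : R -> R,
    (forall x, is_derive p x (g x + -1 * p x)) /\ (forall x, Rabs (p x) <= M) /\
    (forall x, is_derive q x (g x + 1 * q x)) /\ (forall x, Rabs (q x) <= M) /\
    (forall x, conv kernel g x = - (1 / 2) * p x + - (1 / 2) * q x) /\
    (forall x, is_RInt_gen (fun y => kernel (x - y) * g y)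
       (Rbar_locally m_infty) (Rbar_locally p_infty) (conv kernel g x)).
Proof.
  intros Hg Hb.
  assert (Hm : filterlim (fun a => exp (1 * a)) (Rbar_locally m_infty) (locally 0)).
  { apply filterlim_ext with (f := exp); [intros a; now rewrite Rmult_1_l|].
    exact is_lim_exp_m. }
  assert (Hp : filterlim (fun a => exp (-1 * a)) (Rbar_locally p_infty) (locally 0)).
  { apply filterlim_ext with (f := fun a => exp (- a)); [intros a; f_equal; ring|].
    apply filterlim_comp with (2 := is_lim_exp_m).
    exact (filterlim_Rbar_opp p_infty). }
  destruct (exp_average 1 (Rbar_locally m_infty) g M) as (p & Hp1 & Hp2 & Hp3); auto.
  { apply Rabs_R1. }
  destruct (exp_average (-1) (Rbar_locally p_infty) g M) as (q & Hq1 & Hq2 & Hq3); auto.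
  { rewrite Rabs_left; lra. }
  assert (H : forall x, is_RInt_gen (fun y => kernel (x - y) * g y)
     (Rbar_locally m_infty) (Rbar_locally p_infty) (- (1 / 2) * p x + - (1 / 2) * q x)).
  { intros x; apply (is_RInt_gen_Chasles (V := R_NormedModule) _ x).
    - apply is_RInt_gen_ext with (f := fun y => scal (- (1 / 2)) (exp (1 * (y - x)) * g y));
        [|apply (is_RInt_gen_scal (V := R_NormedModule)), Hp3].
      apply Filter_prod with (Q := fun a => a < x) (R := fun b => b = x);
        [now exists x|reflexivity|].
      intros a b Ha -> y Hy; simpl in Hy; rewrite Rmin_left, Rmax_right in Hy by lra.
      unfold kernel; rewrite sign_eq_1, Rabs_right by lra.
      replace (- (x - y)) with (1 * (y - x)) by ring.
      unfold scal; simpl; unfold mult; simpl; ring.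
    (* The average [q] runs from plus infinity down to [x]; reversing its orientation turns the
       kernel's [+ 1 / 2] on the right half into [- (1 / 2)]. *)
    - replace (- (1 / 2) * q x) with (opp (scal (1 / 2) (q x)))
        by (unfold opp, scal; simpl; unfold mult; simpl; field).
      apply (is_RInt_gen_swap (V := R_NormedModule)).
      apply is_RInt_gen_ext with (f := fun y => scal (1 / 2) (exp (-1 * (y - x)) * g y));
        [|apply (is_RInt_gen_scal (V := R_NormedModule)), Hq3].
      apply Filter_prod with (Q := fun a => x < a) (R := fun b => b = x);
        [now exists x|reflexivity|].
      intros a b Ha -> y Hy; simpl in Hy; rewrite Rmin_right, Rmax_left in Hy by lra.
      unfold kernel; rewrite sign_eq_m1, Rabs_left by lra.
      replace (- - (x - y)) with (-1 * (y - x)) by ring.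
      unfold scal; simpl; unfold mult; simpl; field. }
  assert (E : forall x, conv kernel g x = - (1 / 2) * p x + - (1 / 2) * q x).
  { intros x; apply (is_RInt_gen_unique (V := R_CompleteNormedModule)), H. }
  exists p, q; refine (conj _ (conj Hp2 (conj _ (conj Hq2 (conj E _))))).
  - intros x; replace (g x + -1 * p x) with (g x + - 1 * p x) by ring; apply Hp1.
  - intros x; replace (g x + 1 * q x) with (g x + - -1 * q x) by ring; apply Hq1.
  - intros x; rewrite E; apply H.
Qed.

Lemma conv_kernel_lincomb (a b : R) (f g : R -> R) (A B : R) :
  (forall x, continuous f x) -> (forall x, Rabs (f x) <= A) ->
  (forall x, continuous g x) -> (forall x, Rabs (g x) <= B) ->
  conv kernel (fun x => a * f x + b * g x) =
  (fun x => a * conv kernel f x + b * conv kernel g x).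
Proof.
  intros Hf HA Hg HB; apply functional_extensionality; intros x.
  destruct (conv_kernel_spec f A Hf HA) as (_ & _ & _ & _ & _ & _ & _ & If).
  destruct (conv_kernel_spec g B Hg HB) as (_ & _ & _ & _ & _ & _ & _ & Ig).
  apply (is_RInt_gen_unique (V := R_CompleteNormedModule)).
  generalize (is_RInt_gen_plus _ _ _ _
    (is_RInt_gen_scal _ a _ (If x)) (is_RInt_gen_scal _ b _ (Ig x))).
  apply is_RInt_gen_ext.
  apply filter_forall; intros ab y _; unfold plus, scal; simpl; unfold mult; simpl; ring.
Qed.

Lemma holder_le_conv k theta :
  0 <= theta <= 1 -> exists C, 0 < C /\ forall g M,
    holder_le k theta g M -> holder_le (S k) theta (conv kernel g) (C * M).
Proof.
  intros Ht.
  destruct (holder_le_ode k theta (-1) Ht) as (C1 & HC1 & H1); [rewrite Rabs_left; lra|].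
  destruct (holder_le_ode k theta 1 Ht Rabs_R1) as (C2 & HC2 & H2).
  exists (1 + C1 + C2); split; [lra|]; intros g M Hg.
  assert (HM := holder_le_nonneg _ _ _ _ Hg).
  destruct (conv_kernel_spec g M) as (p & q & Hp & Hpb & Hq & Hqb & E & _);
    [exact (holder_le_continuous _ _ _ _ Hg)|exact (holder_le_bound _ _ _ _ Hg)|].
  specialize (H1 _ _ _ Hp Hpb Hg); specialize (H2 _ _ _ Hq Hqb Hg).
  assert (H1p := holder_le_nonneg _ _ _ _ H1).
  assert (H2p := holder_le_nonneg _ _ _ _ H2).
  (* This is [- (p' + q') / 2] after substituting the two equations. No derivative is left in it,
     which is the gain of one order. *)
  apply holder_le_S with
    (fun x => 1 * (-1 * g x + (1 / 2) * p x) + - (1 / 2) * q x).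
  - intros x; rewrite E.
    assert (Hpx := proj1 (Rabs_le_between _ _) (Hpb x)).
    assert (Hqx := proj1 (Rabs_le_between _ _) (Hqb x)).
    apply Rabs_le; lra.
  - intros x; apply is_derive_ext with (fun x => - (1 / 2) * p x + - (1 / 2) * q x);
      [intros y; now rewrite E|].
    replace (1 * (-1 * g x + 1 / 2 * p x) + - (1 / 2) * q x)
      with (- (1 / 2) * (g x + -1 * p x) + - (1 / 2) * (g x + 1 * q x)) by field.
    apply (is_derive_plus (fun x => - (1 / 2) * p x) (fun x => - (1 / 2) * q x));
      now apply is_derive_scal.
  - generalize (holder_le_lincomb _ _ 1 (- (1 / 2)) _ _ _ _
      (holder_le_lincomb _ _ (-1) (1 / 2) _ _ _ _ Hg H1) H2); intros H.
    apply holder_le_weaken with (1 := H).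
    rewrite (Rabs_left (-1)), Rabs_Ropp, Rabs_R1, (Rabs_right (1 / 2)) by lra; lra.
Qed.

(** * Curves measured by norm bounds *)

(* [N f M] reads "the norm of [f] is at most [M]". *)
Record norm_bound {D : Type} (N : (D -> R) -> R -> Prop) : Prop := {
  nb_nonneg : forall f A, N f A -> 0 <= A;
  nb_weaken : forall f A B, N f A -> A <= B -> N f B;
  nb_lincomb : forall a b f g A B, N f A -> N g B ->
    N (fun x => a * f x + b * g x) (Rabs a * A + Rabs b * B)
}.

(** Linearity is asked only on functions of finite norm: the convolution of an arbitrary function
    may diverge, and [RInt_gen] is then unspecified. *)
Definition bounded_linear {D1 D2 : Type} (N1 : (D1 -> R) -> R -> Prop)
    (N2 : (D2 -> R) -> R -> Prop) (L : (D1 -> R) -> (D2 -> R)) : Prop :=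
  (exists C, 0 < C /\ forall f A, N1 f A -> N2 (L f) (C * A)) /\
  forall a b f g A B, N1 f A -> N1 g B ->
    L (fun x => a * f x + b * g x) = (fun x => a * L f x + b * L g x).

Definition vanishes {D : Type} (N : (D -> R) -> R -> Prop)
    (F : (R -> Prop) -> Prop) (q : R -> D -> R) : Prop :=
  forall eps : posreal, F (fun s => N (q s) eps).

(* As in [Defs], with [N] in place of an [Rbar]-valued norm. *)
Definition norm_continuous {D} (N : (D -> R) -> R -> Prop) (T : R) (v : R -> D -> R) : Prop :=
  (forall t, time T t -> exists M, N (v t) M) /\
  forall t, time T t ->
    vanishes N (within (time T) (locally t)) (fun s x => v s x - v t x).

Definition norm_derivative {D} (N : (D -> R) -> R -> Prop) (T : R) (v w : R -> D -> R) : Prop :=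
  forall t, time T t -> vanishes N (within (time T) (locally' t))
    (fun s x => (v s x - v t x) / (s - t) - w t x).

Fixpoint norm_C {D} (N : (D -> R) -> R -> Prop) (T : R) (n : nat) (v : R -> D -> R) : Prop :=
  match n with
  | O => norm_continuous N T v
  | S m => (forall t, time T t -> exists M, N (v t) M) /\
           exists w, norm_derivative N T v w /\ norm_C N T m w
  end.

Section Vanishing.

Context {D : Type} (N : (D -> R) -> R -> Prop) (HN : norm_bound N).
Context (F : (R -> Prop) -> Prop) {FF : Filter F}.

(** The zero function is reached as [0 * f + 0 * f], so some [f] of finite norm must be supplied. *)
Lemma nb_zero f A : N f A -> N (fun _ => 0) 0.
Proof.
  intros H; generalize (nb_lincomb N HN 0 0 _ _ _ _ H H).
  rewrite Rabs_R0, !Rmult_0_l, Rplus_0_l.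
  now replace (fun x => 0 * f x + 0 * f x) with (fun _ : D => 0)
    by (apply functional_extensionality; intros; ring).
Qed.

Lemma vanishes_lincomb a b p q :
  vanishes N F p -> vanishes N F q -> vanishes N F (fun s x => a * p s x + b * q s x).
Proof.
  intros Hp Hq eps.
  assert (H0 : 0 < Rabs a + Rabs b + 1)
    by (generalize (Rabs_pos a) (Rabs_pos b); lra).
  assert (He : 0 < eps / (Rabs a + Rabs b + 1))
    by (apply Rdiv_lt_0_compat; [apply eps|exact H0]).
  generalize (filter_and _ _ (Hp (mkposreal _ He)) (Hq (mkposreal _ He))).
  apply filter_imp; intros s [H1 H2].
  apply (nb_weaken N HN) with (1 := nb_lincomb N HN a b _ _ _ _ H1 H2); simpl.
  rewrite <- Rmult_plus_distr_r.
  apply Rle_trans with ((Rabs a + Rabs b + 1) * (eps / (Rabs a + Rabs b + 1)));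
    [nra|right; field; lra].
Qed.

Lemma vanishes_ext p q :
  vanishes N F p -> F (fun s => p s = q s) -> vanishes N F q.
Proof.
  intros Hp H eps; generalize (filter_and _ _ H (Hp eps)); apply filter_imp.
  now intros s [<- Hs].
Qed.

Lemma vanishes_mult (C B : R) p r :
  0 < C ->
  (forall f g A B, N f A -> N g B -> N (fun x => f x * g x) (C * (A * B))) ->
  vanishes N F p -> F (fun s => N (r s) B) -> vanishes N F (fun s x => p s x * r s x).
Proof.
  intros HC HM Hp Hr eps.
  assert (H0 : 0 < C * (Rabs B + 1))
    by (apply Rmult_lt_0_compat; [exact HC|generalize (Rabs_pos B); lra]).
  assert (He : 0 < eps / (C * (Rabs B + 1)))
    by (apply Rdiv_lt_0_compat; [apply eps|exact H0]).
  generalize (filter_and _ _ (Hp (mkposreal _ He)) Hr).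
  apply filter_imp; intros s [H1 H2].
  apply (nb_weaken N HN) with (1 := HM _ _ _ _ H1 H2); simpl.
  apply Rle_trans with (C * (eps / (C * (Rabs B + 1)) * (Rabs B + 1))).
  - apply Rmult_le_compat_l; [lra|]; apply Rmult_le_compat_l; [lra|].
    generalize (Rle_abs B); lra.
  - right; field; generalize (Rabs_pos B); lra.
Qed.

End Vanishing.

Lemma vanishes_map {D1 D2} (N1 : (D1 -> R) -> R -> Prop) (N2 : (D2 -> R) -> R -> Prop)
    (F : (R -> Prop) -> Prop) {FF : Filter F} L p :
  bounded_linear N1 N2 L -> vanishes N1 F p -> vanishes N2 F (fun s => L (p s)).
Proof.
  intros [(C & HC & HL) _] Hp eps.
  assert (He : 0 < eps / C) by (apply Rdiv_lt_0_compat; [apply eps|exact HC]).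
  generalize (Hp (mkposreal _ He)); apply filter_imp; intros s Hs.
  apply HL in Hs; simpl in Hs; now replace (C * (eps / C)) with (eps : R) in Hs by (field; lra).
Qed.

Section NormCurves.

Context {D : Type} (N : (D -> R) -> R -> Prop) (HN : norm_bound N) (T : R).

Lemma norm_C_mem n v : norm_C N T n v -> forall t, time T t -> exists M, N (v t) M.
Proof. destruct n; intros H; apply H. Qed.

Lemma within_locally_locally' (P : R -> Prop) t :
  within (time T) (locally t) P -> within (time T) (locally' t) P.
Proof. apply (filter_imp (F := locally t)); auto. Qed.

Lemma within_time_locally (P : R -> Prop) t :
  (forall s, time T s -> P s) -> within (time T) (locally t) P.
Proof. intros H; apply (filter_forall (F := locally t)); auto. Qed.

Lemma within_time_locally' (P : R -> Prop) t :
  (forall s, time T s -> s <> t -> P s) -> within (time T) (locally' t) P.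
Proof. intros H; apply (filter_forall (F := locally t)); intros s Hst Hs; auto. Qed.

(** The increment is [s - t] times the sum of the quotient's error and [w t]. The filter of the
    derivative omits [s = t], which is treated apart. *)
Lemma norm_derivative_continuous v w :
  (forall t, time T t -> exists M, N (v t) M) ->
  (forall t, time T t -> exists M, N (w t) M) ->
  norm_derivative N T v w -> norm_continuous N T v.
Proof.
  intros Hv Hw Hd; split; [exact Hv|]; intros t Ht eps.
  destruct (Hw t Ht) as [M HM].
  assert (HM0 := nb_nonneg N HN _ _ HM).
  assert (He : 0 < eps / 2) by (generalize (cond_pos eps); lra).
  assert (Hd0 : 0 < Rmin 1 (eps / 2 / (M + 1)))
    by (apply Rmin_pos; [lra|apply Rdiv_lt_0_compat; lra]).
  assert (Hball : locally t (fun s => Rabs (s - t) < Rmin 1 (eps / 2 / (M + 1))))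
    by (exists (mkposreal _ Hd0); intros s Hs; exact Hs).
  generalize (filter_and _ _ Hball (Hd t Ht (mkposreal _ He))).
  apply (filter_imp (F := locally t)); intros s [H1 H2] Hs.
  destruct (Req_dec s t) as [->|Hst].
  - replace (fun x => v t x - v t x) with (fun _ : D => 0)
      by (apply functional_extensionality; intros; ring).
    apply (nb_weaken N HN) with 0; [exact (nb_zero N HN _ _ HM)|].
    left; apply cond_pos.
  - specialize (H2 Hst Hs); simpl in H2.
    generalize (nb_lincomb N HN (s - t) (s - t) _ _ _ _ H2 HM).
    replace (fun x => (s - t) * ((v s x - v t x) / (s - t) - w t x) + (s - t) * w t x)
      with (fun x => v s x - v t x)
      by (apply functional_extensionality; intros; field; lra).
    intros H; apply (nb_weaken N HN) with (1 := H).
    assert (Ha := Rlt_le_trans _ _ _ H1 (Rmin_l _ _)).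
    assert (Hb := Rlt_le_trans _ _ _ H1 (Rmin_r _ _)).
    apply Rle_trans with (1 * (eps / 2) + (eps / 2 / (M + 1)) * (M + 1)).
    + apply Rplus_le_compat; [apply Rmult_le_compat_r; lra|].
      apply Rmult_le_compat; try lra; apply Rabs_pos.
    + right; field; lra.
Qed.

Lemma norm_C_pred n v : norm_C N T (S n) v -> norm_C N T n v.
Proof.
  revert v; induction n as [|n IH]; intros v (Hv & w & Hw & HC).
  - apply norm_derivative_continuous with w; auto; apply HC.
  - split; [exact Hv|]; exists w; split; auto.
Qed.

Lemma norm_C_continuous n v : norm_C N T n v -> norm_continuous N T v.
Proof. revert v; induction n; intros v H; [exact H|]; apply IHn, norm_C_pred, H. Qed.

(** The same derivative curve serves both, so a case distinction on [n] replaces induction. *)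
Lemma norm_C_ext n v v' :
  (forall t, time T t -> v t = v' t) -> norm_C N T n v -> norm_C N T n v'.
Proof.
  intros E; assert (Hm : (forall t, time T t -> exists M, N (v t) M) ->
                         forall t, time T t -> exists M, N (v' t) M).
  { intros H t Ht; rewrite <- E; auto. }
  destruct n as [|n].
  - intros (Hv & Hc); split; auto.
    intros t Ht; apply (vanishes_ext N _ _ _ (Hc t Ht)).
    apply within_time_locally; intros s Hs; now rewrite !E.
  - intros (Hv & w & Hw & HC); split; auto; exists w; split; [|exact HC].
    intros t Ht; apply (vanishes_ext N _ _ _ (Hw t Ht)).
    apply within_time_locally'; intros s Hs _; now rewrite !E.
Qed.

Lemma norm_C_lincomb n a b v v' :
  norm_C N T n v -> norm_C N T n v' -> norm_C N T n (fun t x => a * v t x + b * v' t x).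
Proof.
  assert (Hm : forall v v', (forall t, time T t -> exists M, N (v t) M) ->
    (forall t, time T t -> exists M, N (v' t) M) ->
    forall t, time T t -> exists M, N (fun x => a * v t x + b * v' t x) M).
  { clear v v'; intros v v' H H' t Ht.
    destruct (H t Ht) as [A HA], (H' t Ht) as [B HB].
    eexists; exact (nb_lincomb N HN a b _ _ _ _ HA HB). }
  revert v v'; induction n as [|n IH]; intros v v'.
  - intros (Hv & Hc) (Hv' & Hc'); split; auto; intros t Ht.
    refine (vanishes_ext _ _ _ _ (vanishes_lincomb N HN _ a b _ _ (Hc t Ht) (Hc' t Ht)) _).
    apply within_time_locally; intros s Hs; apply functional_extensionality; intros x; ring.
  - intros (Hv & w & Hw & HC) (Hv' & w' & Hw' & HC'); split; auto.
    exists (fun t x => a * w t x + b * w' t x); split; [|now apply IH].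
    intros t Ht; refine (vanishes_ext _ _ _ _
      (vanishes_lincomb N HN _ a b _ _ (Hw t Ht) (Hw' t Ht)) _).
    apply within_time_locally'; intros s Hs Hst.
    apply functional_extensionality; intros x; field; lra.
Qed.

Lemma norm_C_const n f M : N f M -> norm_C N T n (fun _ => f).
Proof.
  intros Hf; assert (H0 := nb_zero N HN _ _ Hf).
  revert f M Hf; induction n as [|n IH]; intros f M Hf; (split; [now exists M|]).
  - intros t Ht eps; apply within_time_locally; intros s _.
    apply (nb_weaken N HN) with 0; [|left; apply cond_pos].
    now replace (fun x => f x - f x) with (fun _ : D => 0)
      by (apply functional_extensionality; intros; ring).
  - exists (fun _ _ => 0); split; [|apply (IH _ _ H0)].
    intros t Ht eps; apply within_time_locally'; intros s _ Hst.
    apply (nb_weaken N HN) with 0; [|left; apply cond_pos].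
    now replace (fun x => (f x - f x) / (s - t) - 0) with (fun _ : D => 0)
      by (apply functional_extensionality; intros; field; lra).
Qed.

Lemma norm_C_mult (C : R) n v v' :
  0 < C ->
  (forall f g A B, N f A -> N g B -> N (fun x => f x * g x) (C * (A * B))) ->
  norm_C N T n v -> norm_C N T n v' -> norm_C N T n (fun t x => v t x * v' t x).
Proof.
  intros HC HM.
  assert (Hm : forall v v', (forall t, time T t -> exists M, N (v t) M) ->
    (forall t, time T t -> exists M, N (v' t) M) ->
    forall t, time T t -> exists M, N (fun x => v t x * v' t x) M).
  { clear v v'; intros v v' H H' t Ht.
    destruct (H t Ht) as [A HA], (H' t Ht) as [B HB].
    eexists; exact (HM _ _ _ _ HA HB). }
  (* In the Leibniz rule one factor is taken at the moving time [s], so a bound uniform for [s] near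
     [t] is needed. *)
  assert (Hloc : forall v, norm_continuous N T v -> forall t, time T t ->
    exists B, within (time T) (locally t) (fun s => N (v s) B)).
  { clear v v'; intros v (Hv & Hc) t Ht; destruct (Hv t Ht) as [B HB].
    exists (Rabs 1 * 1 + Rabs 1 * B); generalize (Hc t Ht (mkposreal 1 Rlt_0_1)).
    apply filter_imp; intros s Hs.
    generalize (nb_lincomb N HN 1 1 _ _ _ _ Hs HB).
    now replace (fun x => 1 * (v s x - v t x) + 1 * v t x) with (v s)
      by (apply functional_extensionality; intros; ring). }
  revert v v'; induction n as [|n IH]; intros v v'.
  - intros (Hv & Hc) Hc0'; assert (Hl := Hloc _ Hc0').
    destruct Hc0' as (Hv' & Hc'); split; auto; intros t Ht.
    destruct (Hl t Ht) as [B HB], (Hv t Ht) as [A HA].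
    refine (vanishes_ext _ _ _ _ (vanishes_lincomb N HN _ 1 1 _ _
       (vanishes_mult N HN _ C B _ v' HC HM (Hc t Ht) HB)
       (vanishes_mult N HN _ C A _ (fun _ => v t) HC HM (Hc' t Ht)
         (filter_forall _ (fun _ => HA)))) _).
    apply within_time_locally; intros s Hs; apply functional_extensionality; intros x; ring.
  - intros HCv HCv'.
    assert (Hl := Hloc _ (norm_C_continuous _ _ HCv')).
    assert (Hc' := proj2 (norm_C_continuous _ _ HCv')).
    assert (HCv0 := norm_C_pred _ _ HCv).
    assert (HCv0' := norm_C_pred _ _ HCv').
    destruct HCv as (Hv & w & Hw & HCw), HCv' as (Hv' & w' & Hw' & HCw').
    split; auto.
    exists (fun t x => 1 * (w t x * v' t x) + 1 * (v t x * w' t x)).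
    split; [|apply norm_C_lincomb; auto].
    intros t Ht; destruct (Hl t Ht) as [B HB], (Hv t Ht) as [A HA],
      (norm_C_mem _ _ HCw t Ht) as [A' HA'].
    assert (Hc1 : vanishes N (within (time T) (locally' t)) (fun s x => v' s x - v' t x))
      by (intros eps; apply within_locally_locally', (Hc' t Ht)).
    (* With [d] and [d'] the quotients of [v] and [v'], the error is [(d - w t) * v' s + w t * (v' s
       - v' t) + v t * (d' - w' t)], and each term has a vanishing factor. *)
    refine (vanishes_ext _ _ _ _ (vanishes_lincomb N HN _ 1 1 _ _
       (vanishes_mult N HN _ C B _ v' HC HM (Hw t Ht) (within_locally_locally' _ _ HB))
       (vanishes_lincomb N HN _ 1 1 _ _
         (vanishes_mult N HN _ C A' _ (fun _ => w t) HC HM Hc1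
           (filter_forall _ (fun _ => HA')))
         (vanishes_mult N HN _ C A _ (fun _ => v t) HC HM (Hw' t Ht)
           (filter_forall _ (fun _ => HA))))) _).
    apply within_time_locally'; intros s Hs Hst.
    apply functional_extensionality; intros x; field; lra.
Qed.

End NormCurves.

Lemma norm_C_map {D1 D2} (N1 : (D1 -> R) -> R -> Prop) (N2 : (D2 -> R) -> R -> Prop)
    (T : R) L n v :
  norm_bound N1 -> bounded_linear N1 N2 L ->
  norm_C N1 T n v -> norm_C N2 T n (fun t => L (v t)).
Proof.
  intros HN HL.
  assert (Hm : forall v, (forall t, time T t -> exists M, N1 (v t) M) ->
    forall t, time T t -> exists M, N2 (L (v t)) M).
  { clear v; intros v H t Ht; destruct (H t Ht) as [A HA].
    destruct HL as [(C & _ & HC) _]; exists (C * A); now apply HC. }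
  revert v; induction n as [|n IH]; intros v.
  - intros (Hv & Hc); split; auto; intros t Ht.
    refine (vanishes_ext _ _ _ _ (vanishes_map _ _ _ L _ HL (Hc t Ht)) _).
    apply within_time_locally; intros s Hs.
    destruct (Hv t Ht) as [A HA], (Hv s Hs) as [B HB].
    replace (fun x => v s x - v t x) with (fun x => 1 * v s x + -1 * v t x)
      by (apply functional_extensionality; intros; ring).
    rewrite (proj2 HL _ _ _ _ _ _ HB HA).
    apply functional_extensionality; intros; ring.
  - intros (Hv & w & Hw & HC); split; auto.
    exists (fun t => L (w t)); split; [|now apply IH].
    intros t Ht; refine (vanishes_ext _ _ _ _ (vanishes_map _ _ _ L _ HL (Hw t Ht)) _).
    apply within_time_locally'; intros s Hs Hst.
    destruct (Hv t Ht) as [A HA], (Hv s Hs) as [B HB],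
      (norm_C_mem _ _ _ _ HC t Ht) as [M HM].
    replace (fun x => (v s x - v t x) / (s - t) - w t x)
      with (fun x => 1 * (/ (s - t) * v s x + - / (s - t) * v t x) + -1 * w t x)
      by (apply functional_extensionality; intros; field; lra).
    rewrite (proj2 HL _ _ _ _ _ _ (nb_lincomb _ HN _ _ _ _ _ _ HB HA) HM).
    rewrite (proj2 HL _ _ _ _ _ _ HB HA).
    apply functional_extensionality; intros; field; lra.
Qed.

(** * Time integrals of curves *)

Lemma RInt_diff_le (f g : R -> R) (a b B : R) :
  a <= b -> (forall t, continuous f t) -> (forall t, continuous g t) ->
  (forall t, a <= t <= b -> Rabs (f t - g t) <= B) ->
  Rabs (RInt f a b - RInt g a b) <= (b - a) * B.
Proof.
  intros Hab Hf Hg H.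
  assert (If : ex_RInt f a b)
    by (apply (ex_RInt_continuous (V := R_CompleteNormedModule)); auto).
  assert (Ig : ex_RInt g a b)
    by (apply (ex_RInt_continuous (V := R_CompleteNormedModule)); auto).
  replace (RInt f a b - RInt g a b) with (RInt (fun t => f t - g t) a b)
    by (apply (RInt_minus (V := R_CompleteNormedModule)); auto).
  apply abs_RInt_le_const; auto.
  now apply (ex_RInt_minus (V := R_NormedModule)).
Qed.

Section SupContinuousCurve.

Context (v : R -> R -> R).
Context (Hv : forall t x, continuous (v t) x).
Context (Hc : forall t (eps : posreal),
  locally t (fun s => forall x, Rabs (v s x - v t x) <= eps)).

(** Going from [(t, x)] to [(s, y)] through [(t, y)], the change in time is small uniformly in [y],
    so continuity in space is needed at the fixed time [t] only. *)
Lemma sup_continuous_jointly t x (eps : posreal) :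
  exists d : posreal, forall s y, Rabs (s - t) < d -> Rabs (y - x) < d ->
    Rabs (v s y - v t x) < eps.
Proof.
  assert (He : 0 < eps / 2) by (generalize (cond_pos eps); lra).
  destruct (Hc t (mkposreal _ He)) as [d1 H1].
  destruct (proj1 (filterlim_locally _ _) (Hv t x) (mkposreal _ He)) as [d2 H2].
  assert (Hd : 0 < Rmin d1 d2) by (apply Rmin_pos; apply cond_pos).
  exists (mkposreal _ Hd); simpl; intros s y Hs Hy.
  assert (A1 := H1 s (Rlt_le_trans _ _ _ Hs (Rmin_l _ _)) y); simpl in A1.
  assert (A2 := H2 y (Rlt_le_trans _ _ _ Hy (Rmin_r _ _))).
  change (Rabs (v t y - v t x) < eps / 2) in A2.
  replace (v s y - v t x) with ((v s y - v t y) + (v t y - v t x)) by ring.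
  apply Rle_lt_trans with (1 := Rabs_triang _ _); lra.
Qed.

Lemma sup_continuous_time x t : continuous (fun s => v s x) t.
Proof.
  apply filterlim_locally; intros eps.
  destruct (sup_continuous_jointly t x eps) as [d Hd]; exists d; intros s Hs.
  apply Hd; [exact Hs|].
  rewrite Rminus_diag, Rabs_R0; apply cond_pos.
Qed.

Lemma sup_continuous_RInt a b x :
  a <= b -> continuous (fun x => RInt (fun s => v s x) a b) x.
Proof.
  intros Hab; apply filterlim_locally; intros eps.
  assert (He : 0 < eps / (b - a + 1)) by (apply Rdiv_lt_0_compat; [apply eps|lra]).
  destruct (uniform_continuity_2d_1d v a b x) with (eps := mkposreal _ He) as [d Hd].
  { intros s _ e; destruct (sup_continuous_jointly s x e) as [d Hd]; now exists d. }
  exists d; intros y Hy; change (Rabs (y - x) < d) in Hy.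
  change (Rabs (RInt (fun s => v s y) a b - RInt (fun s => v s x) a b) < eps).
  apply Rle_lt_trans with ((b - a) * (eps / (b - a + 1))).
  - apply RInt_diff_le; [exact Hab|apply sup_continuous_time..|].
    intros s Hs; left; apply (Hd s x s y); auto.
    + generalize (cond_pos d); lra.
    + apply Rabs_lt_between in Hy; lra.
    + rewrite Rminus_diag, Rabs_R0; apply cond_pos.
  - apply Rlt_le_trans with ((b - a + 1) * (eps / (b - a + 1))); [nra|].
    right; field; lra.
Qed.

End SupContinuousCurve.

Lemma holder_le_norm_bound k theta : norm_bound (holder_le k theta).
Proof.
  split; [apply holder_le_nonneg|apply holder_le_weaken|].
  intros; now apply holder_le_lincomb.
Qed.

(** Compactness of the time interval. The number [d] chosen at [t] is both a radius and, through
    [/ d], a bound on that neighbourhood; the positive lower bound for [d] given by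
    [compactness_value_1d] is therefore a uniform bound on the curve. *)
Lemma norm_continuous_bounded {D} (N : (D -> R) -> R -> Prop) (HN : norm_bound N) T v :
  norm_continuous N T v -> exists B, forall t, time T t -> N (v t) B.
Proof.
  intros [Hm Hc].
  assert (H : forall t, exists d : posreal, time T t ->
    forall s, time T s -> Rabs (s - t) < d -> N (v s) (/ d)).
  { intros t; destruct (classic (time T t)) as [Ht|Ht];
      [|exists (mkposreal 1 Rlt_0_1); contradiction].
    destruct (Hm t Ht) as [M HM], (Hc t Ht (mkposreal 1 Rlt_0_1)) as [d Hd].
    assert (HM0 := nb_nonneg N HN _ _ HM).
    assert (Hp : 0 < Rmin d (/ (1 + M)))
      by (apply Rmin_pos; [apply cond_pos|apply Rinv_0_lt_compat; lra]).
    exists (mkposreal _ Hp); simpl; intros _ s Hs Hst.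
    assert (H1 := Hd s (Rlt_le_trans _ _ _ Hst (Rmin_l _ _)) Hs); simpl in H1.
    generalize (nb_lincomb N HN 1 1 _ _ _ _ H1 HM).
    replace (fun x => 1 * (v s x - v t x) + 1 * v t x) with (v s)
      by (apply functional_extensionality; intros; ring).
    intros H2; apply (nb_weaken N HN) with (1 := H2); rewrite Rabs_R1.
    rewrite <- (Rinv_inv (1 * 1 + 1 * M)); apply Rinv_le_contravar; [exact Hp|].
    replace (1 * 1 + 1 * M) with (1 + M) by ring; apply Rmin_r. }
  apply functional_choice in H; destruct H as [delta Hd].
  destruct (compactness_value_1d (- T) T delta) as [d Hcov].
  exists (/ d); intros s Hs; apply NNPP; intros Hn; apply (Hcov s Hs).
  intros (t & Ht & Hst & Hle); apply Hn.
  apply (nb_weaken N HN) with (1 := Hd t Ht s Hs Hst).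
  apply Rinv_le_contravar; [apply cond_pos|exact Hle].
Qed.

Lemma holder_le_Derive_minus k theta f g A B M :
  holder_le (S k) theta f A -> holder_le (S k) theta g B ->
  holder_le (S k) theta (fun x => f x - g x) M ->
  holder_le k theta (fun x => Derive f x - Derive g x) M.
Proof.
  intros Hf Hg (_ & _ & H).
  replace (fun x => Derive f x - Derive g x) with (Derive (fun x => f x - g x)); [exact H|].
  apply functional_extensionality; intros x; apply Derive_minus;
    [apply Hf|apply Hg].
Qed.

(** Sup and Hölder bounds integrate directly, and continuity in the norm justifies differentiation
    under the integral. The bound loses no constant, so an average over [[a, b]] is bounded by the
    same [M] as the integrand. *)
Lemma holder_le_RInt k theta v a b M :
  (forall t, exists A, holder_le k theta (v t) A) ->
  (forall t, vanishes (holder_le k theta) (locally t) (fun s x => v s x - v t x)) ->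
  a <= b -> (forall s, a <= s <= b -> holder_le k theta (v s) M) ->
  holder_le k theta (fun x => RInt (fun s => v s x) a b) ((b - a) * M).
Proof.
  revert v; induction k as [|k IH]; intros v Hm Hc Hab HM;
    assert (Hv : forall t x, continuous (v t) x)
      by (intros t; destruct (Hm t) as [A HA]; exact (holder_le_continuous _ _ _ _ HA));
    assert (Hs : forall t (eps : posreal),
      locally t (fun s => forall x, Rabs (v s x - v t x) <= eps))
      by (intros t eps; generalize (Hc t eps); apply filter_imp;
          intros s H; exact (holder_le_bound _ _ _ _ H));
    assert (Hvt := sup_continuous_time v Hv Hs);
    assert (Hex : forall x, ex_RInt (fun s => v s x) a b)
      by (intros; apply (ex_RInt_continuous (V := R_CompleteNormedModule)); auto);
    assert (Hb : forall x, Rabs (RInt (fun s => v s x) a b) <= (b - a) * M)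
      by (intros x; apply abs_RInt_le_const; auto;
          intros t Ht; exact (holder_le_bound _ _ _ _ (HM t Ht) x)).
  - split; [|split; [exact Hb|]].
    + intros x; now apply sup_continuous_RInt.
    + intros x y Hxy; rewrite Rmult_assoc; apply RInt_diff_le; auto.
      intros t Ht; now apply (HM t Ht).
  - assert (Hc' : forall t, vanishes (holder_le k theta) (locally t)
      (fun s x => Derive (v s) x - Derive (v t) x)).
    { intros t eps; generalize (Hc t eps); apply filter_imp; intros s H.
      destruct (Hm s) as [A HA], (Hm t) as [B HB].
      now apply holder_le_Derive_minus with (1 := HA) (2 := HB). }
    assert (Hm' : forall t, exists A, holder_le k theta (Derive (v t)) A)
      by (intros t; destruct (Hm t) as [A HA]; exists A; apply HA).
    apply holder_le_S with (fun x => RInt (fun s => Derive (v s) x) a b); [exact Hb| |].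
    + intros x; apply (is_derive_RInt_param (fun x s => v s x)).
      * apply filter_forall; intros y t _; destruct (Hm t) as [A HA]; apply HA.
      * intros t _ eps.
        destruct (sup_continuous_jointly (fun s => Derive (v s)))
          with (t := t) (x := x) (eps := eps) as [d Hd].
        -- intros s; destruct (Hm' s) as [A HA]; exact (holder_le_continuous _ _ _ _ HA).
        -- intros s e; generalize (Hc' s e); apply filter_imp.
           intros r Hr; exact (holder_le_bound _ _ _ _ Hr).
        -- exists d; intros; now apply Hd.
      * apply filter_forall; auto.
    + apply IH; auto; intros s Hs'; now apply HM.
Qed.

(** Freezing a curve beyond the endpoints extends it continuously to all times, as the lemmas on
    parametric integrals require; values of the original curve outside the interval are
    arbitrary. *)
Definition clamp (T s : R) : R := Rmax (- T) (Rmin T s).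

Lemma clamp_time T s : 0 < T -> time T (clamp T s).
Proof. unfold time, clamp, Rmax, Rmin; repeat destruct Rle_dec; lra. Qed.

Lemma clamp_id T s : time T s -> clamp T s = s.
Proof. unfold time, clamp, Rmax, Rmin; repeat destruct Rle_dec; lra. Qed.

Lemma clamp_contraction T s t : 0 < T -> Rabs (clamp T s - clamp T t) <= Rabs (s - t).
Proof.
  intros HT; apply Rabs_le; unfold clamp, Rmax, Rmin, Rabs;
    repeat destruct Rle_dec; destruct Rcase_abs; lra.
Qed.

(** The error of the difference quotient at [t] is the average of [v r - v t] for [r] between [t]
    and [s], hence no larger than the oscillation of [v] there. *)
Lemma holder_le_integral_derivative k theta T v :
  0 < T -> norm_continuous (holder_le k theta) T v ->
  norm_derivative (holder_le k theta) T (fun t x => RInt (fun s => v s x) 0 t) v /\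
  forall t, time T t -> exists M, holder_le k theta (fun x => RInt (fun s => v s x) 0 t) M.
Proof.
  intros HT [Hm Hc].
  set (z := fun s => v (clamp T s)).
  assert (Hzm : forall t, exists A, holder_le k theta (z t) A)
    by (intros t; apply Hm; now apply clamp_time).
  assert (Hzc : forall t,
    vanishes (holder_le k theta) (locally t) (fun s x => z s x - z t x)).
  { intros t eps; destruct (Hc _ (clamp_time T t HT) eps) as [d Hd].
    exists d; intros s Hs; apply Hd; [|now apply clamp_time].
    apply Rle_lt_trans with (2 := Hs), (clamp_contraction T s t HT). }
  assert (Hzs : forall x t, continuous (fun s => z s x) t).
  { intros x t; apply sup_continuous_time.
    - intros s; destruct (Hzm s) as [A HA]; exact (holder_le_continuous _ _ _ _ HA).
    - intros s e; generalize (Hzc s e); apply filter_imp.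
      intros r Hr; exact (holder_le_bound _ _ _ _ Hr). }
  assert (Hex : forall x a b, ex_RInt (fun s => z s x) a b)
    by (intros; apply (ex_RInt_continuous (V := R_CompleteNormedModule)); auto).
  assert (HW : forall t x, time T t -> RInt (fun s => v s x) 0 t = RInt (fun s => z s x) 0 t).
  { intros t x Ht; apply RInt_ext; intros s Hs; unfold z; rewrite clamp_id; auto.
    revert Hs Ht; unfold time, Rmin, Rmax; destruct Rle_dec; lra. }
  assert (HWd : forall a b x, time T a -> time T b ->
    RInt (fun s => v s x) 0 b - RInt (fun s => v s x) 0 a = RInt (fun s => z s x) a b).
  { intros a b x Ha Hb; rewrite !HW by auto.
    apply (Rplus_eq_reg_l (RInt (fun s => z s x) 0 a)).
    transitivity (RInt (fun s => z s x) 0 b); [ring|symmetry].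
    now apply (RInt_Chasles (V := R_CompleteNormedModule)). }
  (* The endpoints are ordered and [t] is left free, so that [t] can be either of them: this serves
     quotients from the left and from the right. *)
  assert (Hq : forall a b t eps, a < b -> time T a -> time T b -> time T t ->
    (forall r, a <= r <= b -> holder_le k theta (fun x => v r x - v t x) eps) ->
    holder_le k theta (fun x =>
      (RInt (fun s => v s x) 0 b - RInt (fun s => v s x) 0 a) / (b - a) - v t x) eps).
  { intros a b t eps Hab Ha Hb Ht Heps.
    assert (H : holder_le k theta
      (fun x => RInt (fun s => z s x - v t x) a b) ((b - a) * eps)).
    { apply holder_le_RInt; [| |lra|].
      - intros s; destruct (Hzm s) as [A HA], (Hm t Ht) as [B HB].
        generalize (holder_le_lincomb _ _ 1 (-1) _ _ _ _ HA HB); intros H1.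
        exists (Rabs 1 * A + Rabs (-1) * B).
        replace (fun x => z s x - v t x) with (fun x => 1 * z s x + -1 * v t x); [exact H1|].
        apply functional_extensionality; intros; ring.
      - intros s e; generalize (Hzc s e); apply filter_imp; intros r Hr.
        replace (fun x => z r x - v t x - (z s x - v t x)) with (fun x => z r x - z s x);
          [exact Hr|].
        apply functional_extensionality; intros; ring.
      - intros s Hs; unfold z; rewrite clamp_id; [now apply Heps|].
        unfold time in *; lra. }
    (* A rescaling, written as a combination whose second coefficient is 0. *)
    generalize (holder_le_lincomb _ _ (/ (b - a)) 0 _ _ _ _ H H).
    rewrite Rabs_R0, Rabs_right by (apply Rle_ge, Rlt_le, Rinv_0_lt_compat; lra).
    replace (/ (b - a) * ((b - a) * eps) + 0 * ((b - a) * eps)) with eps by (field; lra).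
    intros H1.
    replace (fun x => (RInt (fun s => v s x) 0 b - RInt (fun s => v s x) 0 a) / (b - a) - v t x)
      with (fun x => / (b - a) * RInt (fun s => z s x - v t x) a b +
                     0 * RInt (fun s => z s x - v t x) a b); [exact H1|].
    apply functional_extensionality; intros x; rewrite HWd by auto.
    replace (RInt (fun s => z s x - v t x) a b)
      with (RInt (fun s => z s x) a b - (b - a) * v t x); [field; lra|].
    transitivity (RInt (fun s => z s x) a b - RInt (fun _ => v t x) a b);
      [f_equal; symmetry; exact (RInt_const (V := R_CompleteNormedModule) a b (v t x))|].
    symmetry; apply (RInt_minus (V := R_CompleteNormedModule) (fun s => z s x) (fun _ => v t x));
      [apply Hex|apply ex_RInt_const]. }
  split.
  - intros t Ht eps; destruct (Hc t Ht eps) as [d Hd].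
    exists d; intros s Hs Hst Hts.
    destruct (Rlt_le_dec s t) as [Hlt|Hle].
    + replace (fun x => (RInt (fun r => v r x) 0 s - RInt (fun r => v r x) 0 t) / (s - t) - v t x)
        with (fun x => (RInt (fun r => v r x) 0 t - RInt (fun r => v r x) 0 s) / (t - s) - v t x)
        by (apply functional_extensionality; intros; field; lra).
      apply Hq; auto; intros r Hr; apply Hd; [|unfold time in *; lra].
      change (Rabs (s - t) < d) in Hs; change (Rabs (r - t) < d).
      apply Rabs_lt_between in Hs; apply Rabs_lt_between; lra.
    + apply Hq; auto; [lra|]; intros r Hr; apply Hd; [|unfold time in *; lra].
      change (Rabs (s - t) < d) in Hs; change (Rabs (r - t) < d).
      apply Rabs_lt_between in Hs; apply Rabs_lt_between; lra.
  - intros t Ht.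
    assert (H0 : time T 0) by (unfold time; lra).
    destruct (norm_continuous_bounded _ (holder_le_norm_bound k theta) T v (conj Hm Hc))
      as [B HB].
    assert (HI : forall a b, a <= b -> time T a -> time T b ->
      holder_le k theta (fun x => RInt (fun s => z s x) a b) ((b - a) * B)).
    { intros a b Hab Ha Hb; apply holder_le_RInt; auto.
      intros s Hs; apply HB, clamp_time, HT. }
    destruct (Rle_lt_dec 0 t) as [Ht0|Ht0].
    + eexists; replace (fun x => RInt (fun s => v s x) 0 t)
        with (fun x => RInt (fun s => z s x) 0 t); [now apply HI|].
      apply functional_extensionality; intros x; now rewrite HW.
    + assert (H := HI t 0 (Rlt_le _ _ Ht0) Ht H0).
      eexists; replace (fun x => RInt (fun s => v s x) 0 t)
        with (fun x => -1 * RInt (fun s => z s x) t 0 + 0 * RInt (fun s => z s x) t 0);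
        [exact (holder_le_lincomb _ _ _ _ _ _ _ _ H H)|].
      apply functional_extensionality; intros x; rewrite <- HWd by auto.
      rewrite RInt_point; unfold zero; simpl; ring.
Qed.

(** * Hölder norms and Hölder bounds *)

Lemma sup_norm_ge f x : Rbar_le (Rabs (f x)) (sup_norm f).
Proof. apply (proj1 (Lub_Rbar_correct _)); now exists x. Qed.

Lemma sup_norm_nonneg f : Rbar_le 0 (sup_norm f).
Proof. apply Rbar_le_trans with (2 := sup_norm_ge f 0), Rabs_pos. Qed.

Lemma sup_norm_le f (M : R) : Rbar_le (sup_norm f) M <-> forall x, Rabs (f x) <= M.
Proof.
  split; intros H.
  - intros x; exact (Rbar_le_trans _ _ _ (sup_norm_ge f x) H).
  - apply (proj2 (Lub_Rbar_correct _)); intros y (x & ->); apply H.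
Qed.

Lemma holder_seminorm_ub theta f h : h <> 0 ->
  Rbar_le (sup_norm (fun x => Rpower (Rabs h) (- theta) * (f (x + h) - f x)))
    (holder_seminorm theta f).
Proof.
  intros Hh; unfold holder_seminorm, Rbar_lub; destruct Rbar_ex_lub as [l [Hu Hl]].
  apply Hu; now exists h.
Qed.

Lemma holder_seminorm_nonneg theta f : Rbar_le 0 (holder_seminorm theta f).
Proof.
  apply Rbar_le_trans with (2 := holder_seminorm_ub theta f 1 R1_neq_R0), sup_norm_nonneg.
Qed.

Lemma holder_seminorm_le theta f (M : R) :
  Rbar_le (holder_seminorm theta f) M <->
  forall x y, x <> y -> Rabs (f x - f y) <= M * Rpower (Rabs (x - y)) theta.
Proof.
  assert (E : forall h d, Rabs (Rpower h (- theta) * d) <= M <-> Rabs d <= M * Rpower h theta).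
  { intros h d; assert (Hp := Rpower_pos h theta).
    rewrite Rpower_Ropp, Rabs_mult, Rabs_right
      by (apply Rle_ge, Rlt_le, Rinv_0_lt_compat, Hp).
    split; intros H.
    - apply Rmult_le_compat_r with (r := Rpower h theta) in H; [|lra].
      now replace (/ Rpower h theta * Rabs d * Rpower h theta) with (Rabs d) in H
        by (field; lra).
    - apply Rmult_le_reg_r with (Rpower h theta); [exact Hp|].
      now replace (/ Rpower h theta * Rabs d * Rpower h theta) with (Rabs d)
        by (field; lra). }
  split; intros H.
  - intros x y Hxy; apply E.
    assert (Hh : x - y <> 0) by lra.
    assert (H1 := Rbar_le_trans _ _ _ (holder_seminorm_ub theta f _ Hh) H).
    generalize (proj1 (sup_norm_le _ _) H1 y); now replace (y + (x - y)) with x by ring.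
  - unfold holder_seminorm, Rbar_lub; destruct Rbar_ex_lub as [l [Hu Hl]]; simpl.
    apply Hl; intros s (h & Hh & ->); apply sup_norm_le; intros x; apply E.
    replace h with (x + h - x) at 2 by ring; apply H; lra.
Qed.

(** [Derive_n] puts each new derivative outermost, whereas [holder_le] recurses on [Derive f]; this
    reconciles the two orders. *)
Lemma Derive_n_Derive f i : Derive_n (Derive f) i = Derive_n f (S i).
Proof.
  apply functional_extensionality; intros x.
  change (Derive f) with (Derive_n f 1); rewrite Derive_n_comp; now rewrite Nat.add_1_r.
Qed.

Lemma class_C_S k f :
  class_C (S k) f <-> (forall x, ex_derive f x) /\ class_C k (Derive f).
Proof.
  assert (E : forall i x, ex_derive_n (Derive f) (S i) x <-> ex_derive_n f (S (S i)) x)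
    by (intros i x; simpl; now rewrite Derive_n_Derive).
  split.
  - intros [Hd Hc]; split; [exact (fun x => Hd 1%nat x ltac:(lia))|split].
    + intros [|i] x Hi; [exact I|]; apply E, Hd; lia.
    + rewrite Derive_n_Derive; exact Hc.
  - intros (H1 & Hd & Hc); split.
    + intros [|[|i]] x Hi; [exact I|apply H1|]; apply E, Hd; lia.
    + rewrite <- Derive_n_Derive; exact Hc.
Qed.

Lemma holder_le_iff k theta f M :
  holder_le k theta f M <->
  class_C k f /\ (forall i x, (i <= k)%nat -> Rabs (Derive_n f i x) <= M) /\
  Rbar_le (holder_seminorm theta (Derive_n f k)) M.
Proof.
  rewrite holder_seminorm_le; revert f; induction k as [|k IH]; intros f.
  - simpl; split.
    + intros (Hc & Hb & Hh); repeat split; auto.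
      * intros [|i] x Hi; [exact I|lia].
      * intros [|i] x Hi; [apply Hb|lia].
    + intros ([_ Hc] & Hb & Hh); repeat split; auto.
      intros x; exact (Hb 0%nat x ltac:(lia)).
  - rewrite class_C_S, <- Derive_n_Derive; split.
    + intros (Hb & Hd & H); apply IH in H; destruct H as (Hc & Hbi & Hh).
      split; [now split|split; [|exact Hh]].
      intros [|i] x Hi; [apply Hb|]; rewrite <- Derive_n_Derive; apply Hbi; lia.
    + intros ((Hd & Hc) & Hbi & Hh).
      split; [intros x; exact (Hbi 0%nat x ltac:(lia))|split; [exact Hd|]].
      apply IH; split; [exact Hc|split; [|exact Hh]].
      intros i x Hi; rewrite Derive_n_Derive; apply Hbi; lia.
Qed.

Lemma Rbar_plus_nonneg a b :
  Rbar_le 0 a -> Rbar_le 0 b -> Rbar_le 0 (Rbar_plus a b).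
Proof. destruct a, b; simpl; auto; lra. Qed.

(** Nonnegativity rules out the sum of opposite infinities, to which [Rbar_plus] gives a default
    value. *)
Lemma Rbar_plus_le_inv a b (M : R) :
  Rbar_le 0 a -> Rbar_le 0 b -> Rbar_le (Rbar_plus a b) M -> Rbar_le a M /\ Rbar_le b M.
Proof. destruct a, b; simpl; intros; try tauto; lra. Qed.

Lemma Rbar_sum_nonneg a k : (forall i, Rbar_le 0 (a i)) -> Rbar_le 0 (Rbar_sum a k).
Proof. intros H; induction k; [apply H|]; now apply Rbar_plus_nonneg. Qed.

Lemma Rbar_sum_le_inv a k (M : R) :
  (forall i, Rbar_le 0 (a i)) -> Rbar_le (Rbar_sum a k) M ->
  forall i, (i <= k)%nat -> Rbar_le (a i) M.
Proof.
  intros Ha; induction k as [|k IH]; intros H i Hi.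
  - now replace i with 0%nat by lia.
  - apply Rbar_plus_le_inv in H; auto using Rbar_sum_nonneg; destruct H as [H1 H2].
    destruct (Nat.eq_dec i (S k)) as [->|Hn]; [exact H2|]; apply IH; auto; lia.
Qed.

Lemma Rbar_sum_le a k (M : R) :
  (forall i, (i <= k)%nat -> Rbar_le (a i) M) ->
  Rbar_le (Rbar_sum a k) ((INR k + 1) * M).
Proof.
  induction k as [|k IH]; intros H.
  - simpl; rewrite Rplus_0_l, Rmult_1_l; apply H; lia.
  - rewrite S_INR; simpl Rbar_sum.
    replace (Finite ((INR k + 1 + 1) * M)) with (Rbar_plus ((INR k + 1) * M) M)
      by (simpl; f_equal; ring).
    apply Rbar_plus_le_compat; [apply IH; auto|apply H; lia].
Qed.

Lemma holder_norm_nonneg k theta f : Rbar_le 0 (holder_norm k theta f).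
Proof.
  apply Rbar_plus_nonneg; [|apply holder_seminorm_nonneg].
  apply Rbar_sum_nonneg; intros i; apply sup_norm_nonneg.
Qed.

(** The class [C^k] is a separate hypothesis because the norm takes the values of [Derive_n] even
    where no derivative exists. *)
Lemma holder_le_of_norm k theta f (M : R) :
  class_C k f -> Rbar_le (holder_norm k theta f) M -> holder_le k theta f M.
Proof.
  assert (Hs : forall i, Rbar_le 0 (sup_norm (Derive_n f i)))
    by (intros; apply sup_norm_nonneg).
  intros Hc H; apply Rbar_plus_le_inv in H; auto using Rbar_sum_nonneg, holder_seminorm_nonneg.
  destruct H as [H1 H2]; apply holder_le_iff; split; [exact Hc|split; [|exact H2]].
  intros i x Hi; apply sup_norm_le.
  exact (Rbar_sum_le_inv _ _ _ Hs H1 i Hi).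
Qed.

(** The factor counts the terms of the norm: [k + 1] sup norms and one seminorm. *)
Lemma holder_norm_le k theta f M :
  holder_le k theta f M -> Rbar_le (holder_norm k theta f) ((INR k + 2) * M).
Proof.
  intros H; apply holder_le_iff in H; destruct H as (_ & Hb & Hh).
  replace (Finite ((INR k + 2) * M)) with (Rbar_plus ((INR k + 1) * M) M)
    by (simpl; f_equal; ring).
  apply Rbar_plus_le_compat; [|exact Hh].
  apply Rbar_sum_le; intros i Hi; apply sup_norm_le; auto.
Qed.

Lemma mem_Holder_iff k theta f : mem (Holder k theta) f <-> exists M, holder_le k theta f M.
Proof.
  split.
  - intros [Hc Hf]; exists (real (holder_norm k theta f)); apply holder_le_of_norm; auto.
    rewrite Hf; apply Rbar_le_refl.
  - intros [M HM]; split; [now apply holder_le_iff in HM|].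
    assert (H1 := holder_norm_le _ _ _ _ HM); assert (H0 := holder_norm_nonneg k theta f).
    unfold is_finite; destruct holder_norm; simpl in *; tauto.
Qed.

(** * The solution *)

(** A bound on one extension already bounds the infimum that defines the norm on [Omega], so no
    near-optimal extension has to be chosen. *)
Definition holder_on_le (j : nat) (eta : R) (Omega : R -> Prop)
    (f : {x : R | Omega x} -> R) (M : R) : Prop :=
  exists F, holder_le j eta F M /\ extends Omega F f.

Lemma bounded_linear_restr j eta Omega :
  bounded_linear (holder_le j eta) (holder_on_le j eta Omega) (restr Omega).
Proof.
  split; [|reflexivity].
  exists 1; split; [lra|]; intros f A H; rewrite Rmult_1_l; exists f; split; [exact H|].
  intros x; reflexivity.
Qed.

(** For [j = k] the spare derivative allows any [eta]; for [j = S k] the inequality on the orders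
    forces [eta <= theta]. *)
Lemma bounded_linear_embed k theta j eta :
  j = k \/ j = S k -> 0 <= eta <= 1 -> INR j + eta <= INR k + 1 + theta ->
  bounded_linear (holder_le (S k) theta) (holder_le j eta) (fun f => f).
Proof.
  intros Hj He Hje; split; [|reflexivity]; exists 2; split; [lra|]; intros f A H.
  destruct Hj as [->| ->]; [now apply holder_le_lower with theta|].
  rewrite S_INR in Hje; apply holder_le_exponent with theta; [lra|exact H].
Qed.

Lemma bounded_linear_conv k theta :
  0 <= theta <= 1 ->
  bounded_linear (holder_le k theta) (holder_le (S k) theta) (conv kernel).
Proof.
  intros Ht; split; [now apply holder_le_conv|].
  intros a b f g A B Hf Hg; apply conv_kernel_lincomb with A B;
    first [exact (holder_le_continuous _ _ _ _ Hf)|exact (holder_le_continuous _ _ _ _ Hg)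
          |exact (holder_le_bound _ _ _ _ Hf)|exact (holder_le_bound _ _ _ _ Hg)].
Qed.

Lemma HolderOn_norm_lt j eta Omega f M eps :
  holder_on_le j eta Omega f M -> (INR j + 2) * M < eps ->
  Rbar_lt (norm_of (HolderOn j eta Omega) f) eps.
Proof.
  intros (F & H & E) Hlt.
  apply Rbar_le_lt_trans with (norm_of (Holder j eta) F).
  - simpl; unfold Rbar_glb; destruct Rbar_ex_glb as [l [Hl Hg]]; simpl.
    apply Hl; exists F; split; [|now split].
    apply (mem_Holder_iff j eta F); now exists M.
  - apply Rbar_le_lt_trans with (1 := holder_norm_le _ _ _ _ H), Hlt.
Qed.

Lemma curve_C_HolderOn j eta Omega T n v :
  norm_C (holder_on_le j eta Omega) T n v -> curve_C (HolderOn j eta Omega) T n v.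
Proof.
  assert (Hm : forall v, (forall t, time T t -> exists M, holder_on_le j eta Omega (v t) M) ->
    forall t, time T t -> mem (HolderOn j eta Omega) (v t)).
  { clear v; intros v H t Ht; destruct (H t Ht) as (M & F & HF & E).
    exists F; split; [|exact E]; apply mem_Holder_iff; now exists M. }
  assert (Hlim : forall F q (eps : posreal), Filter F ->
    vanishes (holder_on_le j eta Omega) F q ->
    F (fun s => Rbar_lt (norm_of (HolderOn j eta Omega) (q s)) eps)).
  { intros F q eps FF Hq; assert (Hj := pos_INR j).
    (* The comparison of norms costs [INR j + 2]; one more unit makes the inequality strict. *)
    assert (He : 0 < eps / (INR j + 3)) by (apply Rdiv_lt_0_compat; [apply eps|lra]).
    generalize (Hq (mkposreal _ He)); apply filter_imp; intros s Hs.
    apply (HolderOn_norm_lt _ _ _ _ _ _ Hs); simpl.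
    apply Rlt_le_trans with ((INR j + 3) * (eps / (INR j + 3))); [nra|].
    right; field; lra. }
  revert v; induction n as [|n IH]; intros v.
  - intros (Hv & Hc); split; [now apply Hm|].
    intros t Ht eps; apply Hlim; [typeclasses eauto|exact (Hc t Ht)].
  - intros (Hv & w & Hw & HC); split; [now apply Hm|].
    exists w; split; [|now apply IH].
    intros t Ht eps; apply Hlim; [typeclasses eauto|exact (Hw t Ht)].
Qed.

Lemma curve_continuous_Holder k theta T v :
  curve_continuous (Holder k theta) T v -> norm_continuous (holder_le k theta) T v.
Proof.
  intros [Hm Hc].
  assert (Hm' : forall t, time T t -> exists M, holder_le k theta (v t) M)
    by (intros; now apply mem_Holder_iff, Hm).
  split; [exact Hm'|]; intros t Ht eps.
  generalize (Hc t Ht eps); apply (filter_imp (F := locally t)); intros s H Hs.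
  apply holder_le_of_norm; [|exact (Rbar_lt_le _ _ (H Hs))].
  destruct (Hm' s Hs) as [A HA], (Hm' t Ht) as [B HB].
  generalize (holder_le_lincomb _ _ 1 (-1) _ _ _ _ HA HB); intros H1.
  apply holder_le_iff in H1; destruct H1 as [H1 _].
  replace (fun x => v s x - v t x) with (fun x => 1 * v s x + -1 * v t x); [exact H1|].
  apply functional_extensionality; intros; ring.
Qed.

Lemma norm_C_integral k theta T n w :
  0 < T -> norm_C (holder_le k theta) T n w ->
  norm_C (holder_le k theta) T (S n) (fun t x => RInt (fun s => w s x) 0 t).
Proof.
  intros HT Hw.
  destruct (holder_le_integral_derivative k theta T w HT) as [Hd Hm].
  { exact (norm_C_continuous _ (holder_le_norm_bound k theta) _ _ _ Hw). }
  split; [exact Hm|]; exists w; now split.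
Qed.

Lemma norm_C_velocity k theta T n u :
  0 <= theta <= 1 -> norm_C (holder_le k theta) T n u ->
  norm_C (holder_le (S k) theta) T n
    (fun t => conv kernel (fun y => u t y + (u t y) ^ 2 / 2)).
Proof.
  intros Ht Hu; assert (HN := holder_le_norm_bound k theta).
  apply (norm_C_map (holder_le k theta) _ T (conv kernel) n
    (fun t y => u t y + (u t y) ^ 2 / 2)); [exact HN|now apply bounded_linear_conv|].
  destruct (holder_le_mult k theta Ht) as (C & HC & HM).
  apply (norm_C_ext _ _ _ (fun t y => 1 * u t y + / 2 * (u t y * u t y))).
  - intros t _; apply functional_extensionality; intros y; field.
  - apply norm_C_lincomb; auto; now apply norm_C_mult with C.
Qed.

(* A solution is [u0] minus [displacement u]. *)
Definition displacement (u : R -> R -> R) (t x : R) : R :=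
  RInt (fun s => conv kernel (fun y => u s y + (u s y) ^ 2 / 2) x) 0 t.

Lemma displacement_smooth k theta T u0 u n :
  0 <= theta <= 1 -> 0 < T -> mem (Holder k theta) u0 -> is_solution k theta T u0 u ->
  norm_C (holder_le (S k) theta) T n (displacement u).
Proof.
  intros Ht HT Hu0 [Hcont Hsol].
  assert (HN := holder_le_norm_bound k theta).
  (* The bootstrap: each pass through the integral equation adds one order in time, with values kept
     at the spatial regularity of [u0]. *)
  assert (Hu : forall n, norm_C (holder_le k theta) T n u).
  { clear n; induction n as [|n IH]; [now apply curve_continuous_Holder|].
    apply (norm_C_ext _ _ _ (fun t x => 1 * u0 x + -1 * displacement u t x)).
    - intros t Htt; apply functional_extensionality; intros x.
      rewrite (Hsol t x Htt); unfold displacement; ring.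
    - apply mem_Holder_iff in Hu0; destruct Hu0 as [M HM].
      apply norm_C_lincomb; [exact HN|now apply norm_C_const with M|].
      apply norm_C_integral; [exact HT|].
      apply (norm_C_map (holder_le (S k) theta) _ T (fun f => f));
        [apply holder_le_norm_bound|apply bounded_linear_embed; auto; lra|].
      now apply norm_C_velocity. }
  (* The final pass keeps the gained spatial derivative. The integral has order [S n] in time, one
     more than the goal. *)
  apply norm_C_pred; [apply holder_le_norm_bound|].
  apply norm_C_integral; [exact HT|]; now apply norm_C_velocity.
Qed.

Theorem theorem1p18 (k : nat) (theta : R) (u0 : R -> R) (Omega : R -> Prop)
    (T : R) (u : R -> R -> R)
    (Htheta : 0 <= theta <= 1)
    (Hu0 : mem (Holder k theta) u0)
    (HOmega : open Omega)
    (HT : 0 < T)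
    (Hu : is_solution k theta T u0 u) :
  (forall (j : nat) (eta : R),
     (j = k \/ j = S k) -> 0 <= eta <= 1 ->
     INR j + eta <= INR k + 1 + theta ->
     mem (HolderOn j eta Omega) (restr Omega u0) ->
     curve_smooth (HolderOn j eta Omega) T (fun t => restr Omega (u t)))
  /\
  (forall (j : nat) (eta : R),
     (j = k \/ j = S k) -> 0 <= eta <= 1 ->
     INR j + eta <= INR k + 1 + theta ->
     ~ mem (HolderOn j eta Omega) (restr Omega u0) ->
     forall t : R, - T <= t <= T ->
       ~ mem (HolderOn j eta Omega) (restr Omega (u t))).
Proof.
  assert (Hsol : forall t x, time T t -> u t x = u0 x - displacement u t x)
    by apply (proj2 Hu).
  assert (HD : forall j eta, (j = k \/ j = S k) -> 0 <= eta <= 1 ->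
    INR j + eta <= INR k + 1 + theta ->
    forall n, norm_C (holder_le j eta) T n (displacement u)).
  { intros j eta Hj He Hje n.
    apply (norm_C_map (holder_le (S k) theta) _ T (fun f => f));
      [apply holder_le_norm_bound|now apply bounded_linear_embed|].
    now apply displacement_smooth with u0. }
  split; intros j eta Hj He Hje.
  - intros (F & HF & E) n; apply curve_C_HolderOn.
    apply mem_Holder_iff in HF; destruct HF as [M HM].
    (* On [Omega] the datum may be replaced by its extension [F] of class [C^{j,eta}], which makes
       the local curve the restriction of a smooth curve on the whole line. *)
    apply (norm_C_ext _ _ _
      (fun t => restr Omega (fun x => 1 * F x + -1 * displacement u t x))).
    + intros t Ht; apply functional_extensionality; intros x.
      specialize (E x); unfold restr in *; rewrite (Hsol _ _ Ht), E; ring.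
    + apply (norm_C_map (holder_le j eta) _ T (restr Omega) n
        (fun t x => 1 * F x + -1 * displacement u t x));
        [apply holder_le_norm_bound|apply bounded_linear_restr|].
      apply norm_C_lincomb; [apply holder_le_norm_bound| |now apply HD].
      now apply norm_C_const with M; [apply holder_le_norm_bound|].
  - intros Hn t Ht (F & HF & E); apply Hn.
    apply mem_Holder_iff in HF; destruct HF as [M HM].
    destruct (norm_C_mem _ _ _ _ (HD j eta Hj He Hje 0%nat) t Ht) as [B HB].
    (* Contrapositive: [F] extends [u t] from [Omega], and adding the displacement recovers an
       extension of [u0]. *)
    exists (fun x => 1 * F x + 1 * displacement u t x); split.
    + apply mem_Holder_iff; eexists; exact (holder_le_lincomb _ _ 1 1 _ _ _ _ HM HB).
    + intros x; specialize (E x); unfold restr in *; rewrite E, (Hsol _ _ Ht); ring.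
Qed.
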